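(* Let $\mathcal{A}=\varinjlim(\mathcal{A}_i,\varphi_i)$ be a strongly maximal TAF algebra and let $\rho:\mathcal{A}\to\operatorname{Alg}\mathcal{N}$ be a nest representation of $\mathcal{A}$ on a Hilbert space $\mathcal{H}$. If $\rho$ is a $*$-representation on the diagonal $\mathcal{A}\cap\mathcal{A}^*$ of $\mathcal{A}$, then the following are equivalent: (i) $\ker\rho$ is a completely meet irreducible ideal of $\mathcal{A}$. (ii) There exist non-zero vectors $g,h\in\mathcal{H}$ such that $0_+=[g]$, $I_-^{\perp}=[h]$ and the rank one operator $R=g\otimes h$ belongs to $\rho(\mathcal{A})$.
   Context: Strongly maximal TAF algebra: for each $i\in\mathbb{N}$, let $\mathfrak{A}_i$ be a finite direct sum of full complex matrix algebras and $\mathcal{A}_i\subseteq\mathfrak{A}_i$ the corresponding direct sum of the upper triangular matrix subalgebras. Let $\varphi_i:\mathfrak{A}_i\to\mathfrak{A}_{i+1}$ be an injective $*$-homomorphism with $\varphi_i(\mathcal{A}_i)\subseteq\mathcal{A}_{i+1}$ (the embedding of $\mathcal{A}_i$ is $*$-extendable) which is regular, i.e. maps each matrix unit to a sum of matrix units. Then $\mathcal{A}=\varinjlim(\mathcal{A}_i,\varphi_i)$ is the norm closure of $\bigcup_i\mathcal{A}_i$ inside the AF C*-algebra $\mathfrak{A}=\varinjlim(\mathfrak{A}_i,\varphi_i)$ (each $\mathfrak{A}_i$ being identified with its image). The diagonal of $\mathcal{A}$ is $\mathcal{A}\cap\mathcal{A}^*$ (adjoints taken in $\mathfrak{A}$).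 Nest representation: a representation is a bounded algebra homomorphism $\rho:\mathcal{A}\to B(\mathcal{H})$; it is a nest representation if the lattice $\operatorname{Lat}\rho(\mathcal{A})$ of closed $\rho(\mathcal{A})$-invariant subspaces is linearly ordered, i.e. a nest $\mathcal{N}$. Writing $\rho:\mathcal{A}\to\operatorname{Alg}\mathcal{N}$ means $\mathcal{N}=\operatorname{Lat}\rho(\mathcal{A})$, where $\operatorname{Alg}\mathcal{N}$ is the algebra of bounded operators leaving every element of $\mathcal{N}$ invariant. Notation: $0_+$ is the minimal non-zero element of $\mathcal{N}$ (with $0_+=0$ if none exists); $I_-$ is the largest element of $\mathcal{N}$ different from $I$, i.e. from $\mathcal{H}$ (with $I_-=I$ if none exists). $[g]$ is the closed linear span of $g$. $g\otimes h$ is the operator $x\mapsto\langle x,h\rangle g$. Ideals of Banach algebras are closed and two-sided. An ideal $\mathcal{J}$ of $\mathcal{A}$ is completely meet irreducible if, for any collection of ideals $\mathcal{J}_a$ containing $\mathcal{J}$, $\mathcal{J}=\bigcap_a\mathcal{J}_a$ implies $\mathcal{J}=\mathcal{J}_a$ for some $a$; equivalently, $\mathcal{J}$ has a unique successor $\mathcal{J}^+$ in the ideal lattice (an ideal $\mathcal{J}^+\supsetneq\mathcal{J}$ contained in every ideal properly containing $\mathcal{J}$; in particular $\mathcal{J}\neq\mathcal{A}$). *)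

(* Defs.v *)
From HB Require Import structures.
From mathcomp Require Import all_boot all_order all_algebra sesquilinear.
From mathcomp Require Import complex.
From mathcomp Require Import all_classical all_reals topology normedtype.

Set Implicit Arguments.
Unset Strict Implicit.
Unset Printing Implicit Defensive.

Import Order.TTheory GRing.Theory Num.Theory Num.Def.
Import numFieldNormedType.Exports.

Local Open Scope classical_set_scope.
Local Open Scope ring_scope.

Reserved Notation "x ** y" (at level 40, left associativity).

(* Complex *-algebras. C*-algebras need not be unital, so the multiplication
   [amul] is not the (unital) ring multiplication of MathComp. *)
HB.mixin Record isStarAlgebra (R : realType) A of GRing.Lmodule R[i] A := {
  amul : A -> A -> A;
  star : A -> A;
  amulA : associative amul;
  amulDl : left_distributive amul +%R;
  amulDr : right_distributive amul +%R;
  amulZl : forall (c : R[i]) (x y : A), amul (c *: x) y = c *: amul x y;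
  amulZr : forall (c : R[i]) (x y : A), amul x (c *: y) = c *: amul x y;
  starD : {morph star : x y / x + y};
  starZ : forall (c : R[i]) (x : A), star (c *: x) = c^* *: star x;
  starK : involutive star;
  starM : forall x y : A, star (amul x y) = amul (star y) (star x);
}.

#[short(type="starAlgType")]
HB.structure Definition StarAlgebra (R : realType) :=
  {A of GRing.Lmodule R[i] A & isStarAlgebra R A}.

Notation "x ** y" := (amul x y) : ring_scope.

(* MathComp norms take values in the field of scalars: here [`|x|] is a
   nonnegative real element of R[i]. *)
HB.mixin Record StarAlgebra_isCstar (R : realType) A
    of CompleteNormedModule R[i] A & isStarAlgebra R A := {
  norm_amul : forall x y : A, `|x ** y| <= `|x| * `|y|;
  cstar_norm : forall x : A, `|star x ** x| = `|x| ^+ 2;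
}.

#[short(type="cstarAlgType")]
HB.structure Definition CstarAlgebra (R : realType) :=
  {A of CompleteNormedModule R[i] A & isStarAlgebra R A
      & StarAlgebra_isCstar R A}.

(* The inner product is linear in its first argument. *)
HB.mixin Record isHilbert (R : realType) H of CompleteNormedModule R[i] H := {
  inner : {dot H for (@conjC R[i])};
  norm_inner : forall x : H, `|x| ^+ 2 = inner x x;
}.

#[short(type="hilbertType")]
HB.structure Definition Hilbert (R : realType) :=
  {H of CompleteNormedModule R[i] H & isHilbert R H}.

Section StarHom.
Variables (R : realType) (A B : starAlgType R).

Definition star_hom (f : A -> B) : Prop :=
  [/\ linear f, {morph f : x y / x ** y} & {morph f : x / star x}].

End StarHom.

Section MatrixAlgebra.
Variables (R : realType) (m : nat) (n : 'I_m -> nat).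
Local Notation C := R[i].

(* The direct sum of the full matrix algebras M_(n k)(C), k < m. *)
Definition matAlg : Type := {dffun forall k : 'I_m, 'M[C]_(n k)}.

HB.instance Definition _ := Choice.on matAlg.

Implicit Types X Y : matAlg.

Definition mat_zero : matAlg := finfun (fun k => 0 : 'M[C]_(n k)).
Definition mat_opp X : matAlg := finfun (fun k => - X k).
Definition mat_add X Y : matAlg := finfun (fun k => X k + Y k).
Definition mat_scale (c : C) X : matAlg := finfun (fun k => c *: X k).
Definition mat_mul X Y : matAlg := finfun (fun k => X k *m Y k).
Definition mat_star X : matAlg := finfun (fun k => (map_mx conjC (X k))^T).

Fact mat_addA : associative mat_add.
Proof. by move=> X Y Z; apply/ffunP => k; rewrite !ffunE addrA. Qed.
Fact mat_addC : commutative mat_add.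
Proof. by move=> X Y; apply/ffunP => k; rewrite !ffunE addrC. Qed.
Fact mat_add0 : left_id mat_zero mat_add.
Proof. by move=> X; apply/ffunP => k; rewrite !ffunE add0r. Qed.
Fact mat_addN : left_inverse mat_zero mat_opp mat_add.
Proof. by move=> X; apply/ffunP => k; rewrite !ffunE addNr. Qed.

HB.instance Definition _ :=
  GRing.isZmodule.Build matAlg mat_addA mat_addC mat_add0 mat_addN.

Fact mat_scaleA c d X : mat_scale c (mat_scale d X) = mat_scale (c * d) X.
Proof. by apply/ffunP => k; rewrite !ffunE scalerA. Qed.
Fact mat_scale1 : left_id 1 mat_scale.
Proof. by move=> X; apply/ffunP => k; rewrite !ffunE scale1r. Qed.
Fact mat_scaleDr : right_distributive mat_scale +%R.
Proof. by move=> c X Y; apply/ffunP => k; rewrite !ffunE scalerDr. Qed.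
Fact mat_scaleDl X : {morph mat_scale^~ X : c d / c + d}.
Proof. by move=> c d; apply/ffunP => k; rewrite !ffunE scalerDl. Qed.

HB.instance Definition _ := GRing.Zmodule_isLmodule.Build C matAlg
  mat_scaleA mat_scale1 mat_scaleDr mat_scaleDl.

Fact mat_mulA : associative mat_mul.
Proof. by move=> X Y Z; apply/ffunP => k; rewrite !ffunE mulmxA. Qed.
Fact mat_mulDl : left_distributive mat_mul +%R.
Proof. by move=> X Y Z; apply/ffunP => k; rewrite !ffunE mulmxDl. Qed.
Fact mat_mulDr : right_distributive mat_mul +%R.
Proof. by move=> X Y Z; apply/ffunP => k; rewrite !ffunE mulmxDr. Qed.
Fact mat_mulZl c X Y : mat_mul (c *: X) Y = c *: mat_mul X Y.
Proof. by apply/ffunP => k; rewrite !ffunE scalemxAl. Qed.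
Fact mat_mulZr c X Y : mat_mul X (c *: Y) = c *: mat_mul X Y.
Proof. by apply/ffunP => k; rewrite !ffunE scalemxAr. Qed.
Fact mat_starD : {morph mat_star : X Y / X + Y}.
Proof. by move=> X Y; apply/ffunP => k; rewrite !ffunE map_mxD linearD. Qed.
Fact mat_starZ c X : mat_star (c *: X) = c^* *: mat_star X.
Proof. by apply/ffunP => k; rewrite !ffunE map_mxZ linearZ. Qed.
Fact mat_starK : involutive mat_star.
Proof.
by move=> X; apply/ffunP => k; rewrite !ffunE; apply/matrixP => i j;
  rewrite !mxE conjCK.
Qed.
Fact mat_starM X Y : mat_star (mat_mul X Y) = mat_mul (mat_star Y) (mat_star X).
Proof. by apply/ffunP => k; rewrite !ffunE map_mxM trmx_mul. Qed.

HB.instance Definition _ := isStarAlgebra.Build R matAlg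
  mat_mulA mat_mulDl mat_mulDr mat_mulZl mat_mulZr
  mat_starD mat_starZ mat_starK mat_starM.

Definition upper_triangular : set matAlg :=
  [set X : matAlg | forall (k : 'I_m) (i j : 'I_(n k)), (j < i)%N -> X k i j = 0].

(* A matrix unit is indexed by its block and its position in that block. *)
Definition mat_index : Type := {k : 'I_m & 'I_(n k) * 'I_(n k)}%type.

Definition mat_unit (t : mat_index) : matAlg :=
  finfun (fun k => \matrix_(i, j)
    (Tagged (fun l => 'I_(n l) * 'I_(n l))%type (i, j) == t)%:R).

End MatrixAlgebra.

Record tafSystem (R : realType) := TafSystem {
  blocks : nat -> nat;
  dims : forall i, 'I_(blocks i) -> nat;
  phi : forall i, matAlg R (@dims i) -> matAlg R (@dims i.+1);
  dims_gt0 : forall i k, (0 < @dims i k)%N;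
  phi_star_hom : forall i, star_hom (@phi i);
  phi_inj : forall i, injective (@phi i);
  phi_upper : forall i X, upper_triangular X -> upper_triangular (@phi i X);
  phi_regular : forall i (t : mat_index (@dims i)),
    exists s : seq (mat_index (@dims i.+1)),
      phi (mat_unit R t) = \sum_(u <- s) mat_unit R u;
}.

Arguments dims {R} _ _ _.
Arguments phi {R _ _} _.

Section Limit.
Variables (R : realType) (S : tafSystem R) (A : cstarAlgType R).
Variable incl : forall i, matAlg R (dims S i) -> A.
Arguments incl : clear implicits.

(* A, with the embeddings [incl i], is a C*-algebra inductive limit of the
   system. Since the connecting maps are injective, the limit is determined up
   to isomorphism by the following: the [incl i] are compatible injective
   *-homomorphisms (hence isometric) whose ranges have dense union. *)
Record is_cstar_limit : Prop := IsCstarLimit {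
  incl_star_hom : forall i, star_hom (incl i);
  incl_inj : forall i, injective (incl i);
  incl_compat : forall i X, incl i.+1 (phi X) = incl i X;
  incl_dense : closure (\bigcup_i range (incl i)) = setT;
}.

Definition taf_algebra : set A :=
  closure (\bigcup_i incl i @` upper_triangular (n := dims S i)).

End Limit.

Section Subspaces.
Variables (R : realType) (V : completeNormedModType R[i]).

Definition closed_subspace (M : set V) : Prop :=
  [/\ closed M, M 0 & forall (c : R[i]) x y, M x -> M y -> M (c *: x + y)].

Definition closed_span (E : set V) : set V := smallest closed_subspace E.

End Subspaces.

Section Ideals.
Variables (R : realType) (A : cstarAlgType R) (T : set A).

Definition alg_diagonal : set A := T `&` (star @` T).

Definition closed_ideal (J : set A) : Prop :=
  [/\ J `<=` T, closed_subspace J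
    & forall x y, T x -> J y -> J (x ** y) /\ J (y ** x)].

(* Intersections are taken in the lattice of ideals of T, whence the factor T:
   the empty collection has intersection T, so that T itself is not
   completely meet irreducible. *)
Definition completely_meet_irreducible (J : set A) : Prop :=
  closed_ideal J /\
  forall F : set (set A),
    (forall K, F K -> closed_ideal K /\ J `<=` K) ->
    J = T `&` \bigcap_(K in F) K -> F J.

End Ideals.

Section Operators.
Variables (R : realType) (H : hilbertType R).

Definition bounded_operator (X : H -> H) : Prop :=
  linear X /\ exists c : R[i], forall v, `|X v| <= c * `|v|.

Definition rank_one (g h : H) : H -> H := fun x => inner x h *: g.

Definition orthocomplement (M : set H) : set H :=
  [set x | forall y, M y -> inner x y = 0].

(* 0_+ and I_-. The first argument of [xget] is the value when no subspace with
   the required property exists; such a subspace is unique when N is a nest. *)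
Definition zero_plus (N : set (set H)) : set H :=
  xget [set 0] [set M | [/\ N M, M <> [set 0] &
    forall M', N M' -> M' <> [set 0] -> M' `<=` M -> M' = M]].

Definition one_minus (N : set (set H)) : set H :=
  xget setT [set M | [/\ N M, M <> setT &
    forall M', N M' -> M' <> setT -> M' `<=` M]].

End Operators.

(* Representations of a closed subalgebra T of A are functions on all of A, of
   which only the values on T are constrained or used. *)
Section Representations.
Variables (R : realType) (A : cstarAlgType R) (T : set A) (H : hilbertType R).
Variable rho : A -> H -> H.

Record representation : Prop := Representation {
  rep_operator : forall x, T x -> bounded_operator (rho x);
  rep_linear : forall (c : R[i]) x y v, T x -> T y ->
    rho (c *: x + y) v = c *: rho x v + rho y v;
  rep_mul : forall x y v, T x -> T y -> rho (x ** y) v = rho x (rho y v);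
  rep_bounded : exists c : R[i], forall x v, T x ->
    `|rho x v| <= c * `|x| * `|v|;
}.

Definition Lat : set (set H) :=
  [set M | closed_subspace M /\ forall x v, T x -> M v -> M (rho x v)].

Definition nest_representation : Prop :=
  representation /\
  forall M N, Lat M -> Lat N -> M `<=` N \/ N `<=` M.

Definition rep_ker : set A := [set x | T x /\ forall v, rho x v = 0].

Definition star_rep_on (D : set A) : Prop :=
  forall x v w, D x -> inner (rho x v) w = inner v (rho (star x) w).

End Representations.

(* Main.v *)
(* For (ii) => (i), let [R = rho a] and let [K] be a closed ideal properly
   containing the kernel. Minimality of [g] and maximality of [I_-] in the nest
   give [b] in [K] with [<rho(b) h, g> != 0]. At every high level there is one
   matrix unit [u] whose range and source projections fix [g] and [h]; the
   corners of [a] and [b] at [u] are approximately multiples of [u], the multiple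
   for [b] staying away from 0. Hence [a] is approximated by elements of [K], and
   [a] lies in every closed ideal properly containing the kernel.

   For (i) => (ii), let [J] be the kernel and [K] its successor. Closed ideals of
   a TAF algebra are determined by their matrix units, so [K \ J] contains one;
   it contains at most one at each level, because two of them generate each other
   modulo [J], which yields an infinite descent towards the diagonal inside a
   finite level. Modulo [J], these units coincide and are fixed or annihilated by
   every matrix unit from either side, so their common image under [rho] spans an
   ideal of [rho(T)]; its range and kernel are invariant, and since the invariant
   subspaces form a nest it has rank one. *)
From HB Require Import structures.
Require Import Defs.
From mathcomp Require Import all_boot all_order all_algebra sesquilinear.
From mathcomp Require Import complex ring lra zify.
From mathcomp Require Import all_classical all_reals topology normedtype.

Set Implicit Arguments.
Unset Strict Implicit.
Unset Printing Implicit Defensive.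

Import Order.TTheory GRing.Theory Num.Theory Num.Def.
Import numFieldNormedType.Exports.

Local Open Scope classical_set_scope.
Local Open Scope ring_scope.

(** * Norms as real numbers, and norms of orthogonal sums *)

(** Two obstacles shape the proof. Elements of a closed ideal are limits of elements of finite
    levels that need not lie in the ideal; a matrix unit at distance less than 1 from a closed ideal
    belongs to it, and this turns approximate into exact membership. Assembling units into an
    approximant of a given element is harder: the number of corners grows with the level, so small
    errors in the corners need not give a small error in the sum. The remedy is a contractive
    projection that fixes a level [m] near the element and keeps only corners that group into
    orthogonal families, one for each matrix unit of level [m]. An orthogonal family costs no more
    than its largest member, so the total error is controlled by a number known before the higher
    level is chosen. In (ii) => (i) the vectors play different roles: the line of [g] is invariant,
    whereas the line of [h] is the complement of an invariant subspace. Self-adjointness of the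
    images of the diagonal projections makes that line invariant under them. *)

Section RealNorm.
Variables (R : realType) (V : normedModType R[i]).
Implicit Types (x y : V) (E : set V).

(** The scalars [R[i]] are only partially ordered; norms with values in [R] make real arithmetic
    available. *)
Definition nm x : R := complex.Re `|x|.

Lemma normE x : `|x| = (nm x)%:C%C.
Proof. by rewrite /nm RRe_real // ger0_real. Qed.

Lemma nm_ge0 x : 0 <= nm x.
Proof. by rewrite -ler0c -normE. Qed.

Lemma nm0 : nm 0 = 0.
Proof. by apply: (@complexI R); rewrite -normE normr0. Qed.

Lemma nmN x : nm (- x) = nm x.
Proof. by rewrite /nm normrN. Qed.

Lemma nmBC x y : nm (x - y) = nm (y - x).
Proof. by rewrite /nm distrC. Qed.

Lemma nmD x y : nm (x + y) <= nm x + nm y.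
Proof. by rewrite -lecR rmorphD /= -!normE ler_normD. Qed.

Lemma nmB x y : nm (x - y) <= nm x + nm y.
Proof. by rewrite -(nmN y) nmD. Qed.

Lemma nm_eq0 x : nm x = 0 -> x = 0.
Proof. by move=> x0; apply/normr0_eq0; rewrite normE x0. Qed.

Lemma nm_sum (I : Type) (r : seq I) (P : pred I) (F : I -> V) :
  nm (\sum_(i <- r | P i) F i) <= \sum_(i <- r | P i) nm (F i).
Proof.
elim: r => [|i r IH]; first by rewrite !big_nil nm0.
rewrite !big_cons; case: ifP => // _.
by apply: le_trans (nmD _ _) _; rewrite lerD2l.
Qed.

Lemma closureP E x :
  closure E x <-> forall e : R, 0 < e -> exists2 y, E y & nm (x - y) < e.
Proof.
split=> [Ex e e0 | Ex].
  have e0' : 0 < (e%:C)%C by rewrite ltcR.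
  have [y [Ey /=]] := Ex _ (nbhsx_ballx x _ e0').
  by rewrite -ball_normE /= normE ltcR => xy; exists y.
move=> B /nbhs_ballP[e /= e0 eB].
have /Ex[y Ey xy] : 0 < complex.Re e by move: e0; rewrite ltcE => /andP[_].
exists y; split=> //; apply: eB; rewrite -ball_normE /= normE.
by rewrite ltcE /= xy andbT; move: e0; rewrite ltcE => /andP[].
Qed.

Lemma closed_approx E x : closed E ->
  (forall e : R, 0 < e -> exists2 y, E y & nm (x - y) < e) -> E x.
Proof. by move=> cE xE; apply: cE; apply/closureP. Qed.

Lemma closedW E :
  (forall x, (forall e : R, 0 < e -> exists2 y, E y & nm (x - y) < e) -> E x) ->
  closed E.
Proof. by move=> H x /closureP/H. Qed.

End RealNorm.

Lemma nmZ (R : realType) (V : normedModType R[i]) (c : R[i]) (x : V) :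
  nm (c *: x) = nm (c : R[i]^o) * nm x.
Proof. by apply: (@complexI R); rewrite rmorphM /= -!normE normrZ. Qed.

Section Closedness.
Variables (R : realType) (V : completeNormedModType R[i]).
Implicit Types (x y : V) (E : set V).

Lemma closed_subspaceP E : E 0 ->
  (forall (c : R[i]) x y, E x -> E y -> E (c *: x + y)) ->
  closed_subspace (closure E).
Proof.
move=> E0 EL; split; first exact: closed_closure.
  exact: subset_closure.
move=> c x y /closureP Ex /closureP Ey; apply/closureP => e e0.
have c0 := @nm_ge0 R R[i]^o c.
have d0 : 0 < e / 2 / (nm (c : R[i]^o) + 1).
  by rewrite divr_gt0 ?divr_gt0 //; lra.
have [x' Ex' xx'] := Ex _ d0.
have [y' Ey' yy'] := Ey (e / 2) ltac:(lra).
exists (c *: x' + y'); first exact: EL.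
rewrite opprD addrACA -scalerBr; apply: le_lt_trans (nmD _ _) _.
rewrite nmZ (splitr e); apply: ler_ltD yy'.
move: xx'; rewrite ltr_pdivlMr; last lra.
move=> /ltW; apply: le_trans; rewrite mulrC ler_wpM2l ?nm_ge0 //; lra.
Qed.

Lemma subspaceD E x y : closed_subspace E -> E x -> E y -> E (x + y).
Proof. by move=> [_ _ EL] Ex Ey; rewrite -(scale1r x); apply: EL. Qed.

Lemma subspaceZ E (c : R[i]) x : closed_subspace E -> E x -> E (c *: x).
Proof. by move=> [_ E0 EL] Ex; rewrite -(addr0 (c *: x)); apply: EL. Qed.

Lemma subspaceB E x y : closed_subspace E -> E x -> E y -> E (x - y).
Proof.
by move=> EE Ex Ey; rewrite -scaleN1r; apply: subspaceD => //; apply: subspaceZ.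
Qed.

Lemma subspace_sum E (I : Type) (r : seq I) (P : pred I) (F : I -> V) :
  closed_subspace E -> (forall i, P i -> E (F i)) ->
  E (\sum_(i <- r | P i) F i).
Proof.
move=> EE EF; elim/big_rec: _ => [|i v Pi Ev]; first by case: EE.
exact: subspaceD (EF i Pi) Ev.
Qed.

End Closedness.

Section StarAlgebraTheory.
Variables (R : realType) (A : starAlgType R).
Implicit Types x y z : A.

Fact amul_is_linear x : linear (amul x).
Proof. by move=> c y z; rewrite amulDr amulZr. Qed.
HB.instance Definition _ x :=
  GRing.isLinear.Build R[i] A A *:%R (amul x) (amul_is_linear x).

Let ramul y x := x ** y.
Fact ramul_is_linear y : linear (ramul y).
Proof. by move=> c x z; rewrite /ramul amulDl amulZl. Qed.
HB.instance Definition _ y :=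
  GRing.isLinear.Build R[i] A A *:%R (ramul y) (ramul_is_linear y).

Fact star_is_additive : additive (@star R A).
Proof.
by move=> x y; rewrite starD -scaleN1r starZ rmorphN1 scaleN1r.
Qed.
HB.instance Definition _ :=
  GRing.isAdditive.Build A A (@star R A) star_is_additive.

Lemma amul0l y : 0 ** y = 0. Proof. exact: (linear0 (ramul y)). Qed.
Lemma amul0r x : x ** 0 = 0. Proof. exact: (linear0 (amul x)). Qed.
Lemma amulBl x y z : (x - y) ** z = x ** z - y ** z.
Proof. exact: (linearB (ramul z)). Qed.
Lemma amulBr x y z : x ** (y - z) = x ** y - x ** z.
Proof. exact: (linearB (amul x)). Qed.
Lemma amul_suml (I : Type) (r : seq I) (P : pred I) (F : I -> A) y :
  (\sum_(i <- r | P i) F i) ** y = \sum_(i <- r | P i) F i ** y.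
Proof. exact: (linear_sum (ramul y)). Qed.
Lemma amul_sumr (I : Type) (r : seq I) (P : pred I) (F : I -> A) x :
  x ** (\sum_(i <- r | P i) F i) = \sum_(i <- r | P i) x ** F i.
Proof. exact: (linear_sum (amul x)). Qed.
Lemma star0 : star (0 : A) = 0. Proof. exact: (raddf0 (@star R A)). Qed.
Lemma star_sum (I : Type) (r : seq I) (P : pred I) (F : I -> A) :
  star (\sum_(i <- r | P i) F i) = \sum_(i <- r | P i) star (F i).
Proof. exact: (raddf_sum (@star R A)). Qed.

Lemma corner_orth (p q p' q' x y : A) :
  star p = p -> star q = q -> star p' = p' -> star q' = q' ->
  p ** p' = 0 -> q ** q' = 0 ->
  star (p ** x ** q) ** (p' ** y ** q') = 0 /\
  (p ** x ** q) ** star (p' ** y ** q') = 0.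
Proof.
move=> sp sq sp' sq' pp qq; rewrite !starM sp sq sp' sq' !amulA.
by split; [rewrite -(amulA _ p) pp | rewrite -(amulA _ q) qq];
  rewrite amul0r !amul0l.
Qed.

End StarAlgebraTheory.

Section CstarNorm.
Variables (R : realType) (A : cstarAlgType R).
Implicit Types x y z : A.

Lemma nm_amul x y : nm (x ** y) <= nm x * nm y.
Proof. by rewrite -lecR rmorphM /= -!normE norm_amul. Qed.

Lemma nm_star_amul x : nm (star x ** x) = nm x ^+ 2.
Proof. by apply: (@complexI R); rewrite rmorphXn /= -!normE cstar_norm. Qed.

Lemma nm_star x : nm (star x) = nm x.
Proof.
suff H y : nm y <= nm (star y).
  by apply/eqP; rewrite eq_le H -{2}(starK x) H.
have [y0|y0] := eqVneq (nm y) 0; first by rewrite y0 nm_ge0.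
have {}y0 : 0 < nm y by rewrite lt_neqAle eq_sym y0 nm_ge0.
by rewrite -(ler_pM2r y0) -expr2 -nm_star_amul nm_amul.
Qed.

Lemma nm_proj_le1 x : star x = x -> x ** x = x -> nm x <= 1.
Proof.
move=> sx xx; have := nm_star_amul x; rewrite sx xx expr2 => /esym.
have [->//|x0 /eqP] := eqVneq (nm x) 0.
by rewrite -{3}(mulr1 (nm x)) (inj_eq (mulfI x0)) => /eqP->.
Qed.

Lemma nm_pisom_le1 x : x ** star x ** x = x -> nm x <= 1.
Proof.
move=> xx; suff : nm x ^+ 2 <= 1 by rewrite expr_le1 ?nm_ge0.
rewrite -nm_star_amul nm_proj_le1 ?starM ?starK //.
by rewrite amulA -!(amulA (star x)) xx.
Qed.

Section OrthogonalSum.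
Variables (I : finType) (P : pred I).

(** For a self-adjoint sum the square of the norm is the norm of the square, and orthogonality
    reduces the square to the sum of the [z i ** z i]. The induction repeats this with [M ^+ 2] and
    pays for the triangle inequality once, at the end. *)
Let sum_orth_pow n (z : I -> A) M : 0 <= M ->
  (forall i, P i -> star (z i) = z i) ->
  (forall i j, P i -> P j -> i != j -> z i ** z j = 0) ->
  (forall i, P i -> nm (z i) <= M) ->
  nm (\sum_(i | P i) z i) ^+ (2 ^ n)%N <= #|I|%:R * M ^+ (2 ^ n)%N.
Proof.
elim: n z M => [|n IH] z M M0 zs zo zM.
  rewrite expn0 !expr1; apply: le_trans (nm_sum _ _ _) _.
  apply: (@le_trans _ _ (\sum_(i | P i) M)); first exact: ler_sum.
  rewrite sumr_const -(mulr_natl M) ler_wpM2r // ler_nat; exact: max_card.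
rewrite expnS !exprM.
have sS : star (\sum_(i | P i) z i) = \sum_(i | P i) z i.
  by rewrite star_sum; apply: eq_bigr.
rewrite -nm_star_amul sS.
have -> : (\sum_(i | P i) z i) ** (\sum_(i | P i) z i)
          = \sum_(i | P i) z i ** z i.
  rewrite amul_suml; apply: eq_bigr => i Pi.
  rewrite amul_sumr (bigD1 i) //= big1 ?addr0 // => j /andP[Pj ji].
  by apply: zo => //; rewrite eq_sym.
apply: IH => [|i Pi|i j Pi Pj ij|i Pi].
- exact: exprn_ge0.
- by rewrite starM zs.
- by rewrite amulA -(amulA (z i)) zo // amul0r amul0l.
- by rewrite -{1}zs // nm_star_amul lerXn2r ?nnegrE ?nm_ge0 // zM.
Qed.

(* The factor [#|I|] of [sum_orth_pow] disappears after taking [2^n]-th roots. *)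
Lemma nm_sum_orth_sa (z : I -> A) M : 0 <= M ->
  (forall i, P i -> star (z i) = z i) ->
  (forall i j, P i -> P j -> i != j -> z i ** z j = 0) ->
  (forall i, P i -> nm (z i) <= M) ->
  nm (\sum_(i | P i) z i) <= M.
Proof.
move=> M0 zs zo zM; rewrite leNgt; apply/negP => SM.
set S := nm _ in SM.
have pow n := sum_orth_pow n M0 zs zo zM.
have S0 : 0 < S by exact: le_lt_trans SM.
have [M00|Mn0] := eqVneq M 0.
  by have := pow 0; rewrite expn0 !expr1 M00 mulr0 leNgt S0.
have Mp : 0 < M by rewrite lt_neqAle eq_sym Mn0.
(* If the norm exceeded [M], the powers of [S / M = 1 + t] would outgrow [#|I|]; Bernoulli's
   inequality makes this effective. *)
pose t := S / M - 1.
have t0 : 0 < t by rewrite subr_gt0 ltr_pdivlMr ?mul1r.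
have bern n : 1 + n%:R * t <= (1 + t) ^+ n.
  elim: n => [|n IHn]; first by rewrite mul0r addr0 expr0.
  rewrite exprS; apply: (@le_trans _ _ ((1 + t) * (1 + n%:R * t))).
    have := mulr_ge0 (mulr_ge0 (ler0n R n) (ltW t0)) (ltW t0).
    rewrite -natr1; lra.
  by rewrite ler_wpM2l //; lra.
have [N NP] : exists N : nat, #|I|%:R < N%:R * t.
  exists (Num.bound (#|I|%:R / t)).
  by rewrite -ltr_pdivrMr //; apply: archi_boundP; rewrite divr_ge0 // ltW.
have := pow N; rewrite -ler_pdivrMr ?exprn_gt0 // -expr_div_n.
apply/negP; rewrite -ltNge; apply: (lt_le_trans NP).
have -> : S / M = 1 + t by rewrite /t; lra.
apply: le_trans (bern _); apply: (@le_trans _ _ ((2 ^ N)%N%:R * t)); last lra.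
by apply: ler_wpM2r; [exact: ltW | rewrite ler_nat ltnW // ltn_expl].
Qed.

(** Reduction to the self-adjoint elements [star (w i) ** w i]: orthogonality on one side removes
    the cross terms, on the other side it makes these elements mutually orthogonal. *)
Lemma nm_sum_orth (w : I -> A) M : 0 <= M ->
  (forall i j, P i -> P j -> i != j ->
     star (w i) ** w j = 0 /\ w i ** star (w j) = 0) ->
  (forall i, P i -> nm (w i) <= M) ->
  nm (\sum_(i | P i) w i) <= M.
Proof.
move=> M0 wo wM.
suff : nm (\sum_(i | P i) w i) ^+ 2 <= M ^+ 2.
  by rewrite ler_pXn2r ?nnegrE ?nm_ge0.
rewrite -nm_star_amul star_sum.
have -> : (\sum_(i | P i) star (w i)) ** (\sum_(i | P i) w i)
          = \sum_(i | P i) star (w i) ** w i.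
  rewrite amul_suml; apply: eq_bigr => i Pi.
  rewrite amul_sumr (bigD1 i) //= big1 ?addr0 // => j /andP[Pj ji].
  by have [] := wo i j Pi Pj; rewrite 1?eq_sym.
apply: nm_sum_orth_sa => [|i Pi|i j Pi Pj ij|i Pi].
- exact: exprn_ge0.
- by rewrite starM starK.
- have [_ wij] := wo i j Pi Pj ij.
  by rewrite amulA -(amulA (star (w i))) wij amul0r amul0l.
- by rewrite nm_star_amul lerXn2r ?nnegrE ?nm_ge0 // wM.
Qed.

End OrthogonalSum.
End CstarNorm.

(** * Matrix units *)

Section NatPartialIsometry.
Variable (R : realType).
Local Notation C := R[i].

Local Notation adj X := ((map_mx conjC X)^T).

(** The diagonal entry [p] of the projection [X *m adj X] at [i] satisfies [p = p ^ 2 + r] with [r]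
    a natural number, because the projection is idempotent with natural entries; hence [p <= 1]. *)
Lemma nat_pisom_row m n (X : 'M[C]_(m, n)) (a : 'I_m -> 'I_n -> nat) :
  (forall i j, X i j = (a i j)%:R) -> X *m adj X *m X = X ->
  forall i, (\sum_j a i j * a i j <= 1)%N.
Proof.
move=> Xa XX i; pose p i h := (\sum_j a i j * a h j)%N.
have Pp i1 h : (X *m adj X) i1 h = (p i1 h)%:R.
  rewrite mxE /p natr_sum; apply: eq_bigr => j _.
  by rewrite !mxE !Xa natrM rmorph_nat.
have /matrixP/(_ i i) : (X *m adj X) *m (X *m adj X) = X *m adj X.
  by rewrite mulmxA XX.
rewrite mxE Pp (eq_bigr (fun h => (p i h * p h i)%:R)); last first.
  by move=> h _; rewrite !Pp natrM.
rewrite -natr_sum => /eqP; rewrite eqr_nat (bigD1 i) //= => /eqP pe.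
by move: pe; rewrite -/(p i i); case: (p i i) => [|[|q]] //; lia.
Qed.

Lemma nat_pisom_col m n (X : 'M[C]_(m, n)) (a : 'I_m -> 'I_n -> nat) :
  (forall i j, X i j = (a i j)%:R) -> X *m adj X *m X = X ->
  forall j, (\sum_i a i j * a i j <= 1)%N.
Proof.
move=> Xa XX; apply: (@nat_pisom_row _ _ (adj X) (fun j i => a i j)).
  by move=> i j; rewrite !mxE Xa rmorph_nat.
have adjK p q (Y : 'M[C]_(p, q)) : adj (adj Y) = Y.
  by apply/matrixP => i j; rewrite !mxE conjCK.
have /= := congr1 (fun Y => adj Y) XX.
by rewrite !map_mxM !trmx_mul /= adjK mulmxA.
Qed.

Lemma nat_sum_sq_le1 n (b : 'I_n -> nat) : (\sum_j b j * b j <= 1)%N ->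
  (forall j, (b j <= 1)%N) /\
  forall j j', b j != 0%N -> b j' != 0%N -> j = j'.
Proof.
move=> b1; split=> [j|j j' bj bj'].
  move: b1; rewrite (bigD1 j) //=; nia.
apply/eqP; apply: contraT => jj'.
move: b1; rewrite (bigD1 j) //= (bigD1 j') 1?eq_sym //=; nia.
Qed.

End NatPartialIsometry.

Section MatrixUnits.
Variables (R : realType) (m : nat) (n : 'I_m -> nat).
Local Notation C := R[i].
Local Notation idx := (mat_index n).
Local Notation M := (matAlg R n).
Implicit Types (X Y : M) (t u v : idx).

Definition mk (k : 'I_m) (i j : 'I_(n k)) : idx :=
  Tagged (fun l => 'I_(n l) * 'I_(n l))%type (i, j).

(** Rows and columns are encoded as diagonal indices: these also index the range and source
    projections, and one equation compares block and position at once, without casts between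
    blocks. *)
Definition row_idx t : idx := mk (tagged t).1 (tagged t).1.
Definition col_idx t : idx := mk (tagged t).2 (tagged t).2.

Definition coef X t : C := X (tag t) (tagged t).1 (tagged t).2.

Definition up_idx t : bool := ((tagged t).1 <= (tagged t).2)%N.

Lemma mk_tagged t : t = mk (tagged t).1 (tagged t).2.
Proof. by case: t => k [i j]. Qed.

Lemma mk_inj k (i j i' j' : 'I_(n k)) :
  (mk i j == mk i' j') = (i == i') && (j == j').
Proof. by rewrite /mk eq_Tagged /= -pair_eqE. Qed.

Lemma coefE k (i j : 'I_(n k)) X : coef X (mk i j) = X k i j.
Proof. by []. Qed.

Lemma matAlgP X Y : (forall t, coef X t = coef Y t) -> X = Y.
Proof.
move=> XY; apply/ffunP => k; apply/matrixP => i j.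
exact: XY (mk i j).
Qed.

Lemma coefD X Y t : coef (X + Y) t = coef X t + coef Y t.
Proof. by rewrite /coef ffunE mxE. Qed.

Lemma coefZ c X t : coef (c *: X) t = c * coef X t.
Proof. by rewrite /coef ffunE mxE. Qed.

Lemma coef0 t : coef 0 t = 0.
Proof. by rewrite /coef ffunE mxE. Qed.

Lemma coef_sum (I : Type) (r : seq I) (P : pred I) (F : I -> M) t :
  coef (\sum_(i <- r | P i) F i) t = \sum_(i <- r | P i) coef (F i) t.
Proof.
elim: r => [|i r IH]; first by rewrite !big_nil coef0.
by rewrite !big_cons; case: ifP; rewrite ?coefD IH.
Qed.

Lemma coef_unit u t : coef (mat_unit R u) t = (t == u)%:R.
Proof. by rewrite /coef ffunE mxE [in RHS](mk_tagged t). Qed.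

Lemma coefM k (i j : 'I_(n k)) X Y :
  coef (X ** Y) (mk i j) = \sum_h coef X (mk i h) * coef Y (mk h j).
Proof. by rewrite /coef ffunE mxE. Qed.

Lemma coef_star k (i j : 'I_(n k)) X : coef (star X) (mk i j) = (coef X (mk j i))^*.
Proof. by rewrite /coef ffunE !mxE. Qed.

Lemma mat_unit_sum X : X = \sum_t coef X t *: mat_unit R t.
Proof.
apply: matAlgP => t; rewrite coef_sum (bigD1 t) //= big1 => [|u ut].
  by rewrite coefZ coef_unit eqxx mulr1 addr0.
by rewrite coefZ coef_unit eq_sym (negbTE ut) mulr0.
Qed.

Lemma mat_unit_neq0 t : mat_unit R t != 0.
Proof.
apply/eqP => /(congr1 (coef^~ t)); rewrite coef_unit coef0 eqxx.
by apply/eqP; rewrite oner_eq0.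
Qed.


Lemma star_unit k (i j : 'I_(n k)) : star (mat_unit R (mk i j)) = mat_unit R (mk j i).
Proof.
apply: matAlgP => -[l [a b]]; rewrite -/(mk a b) coef_star !coef_unit rmorph_nat.
congr ((nat_of_bool _)%:R); have [lk|lk] := eqVneq l k.
  by subst l; rewrite !mk_inj andbC.
by apply/eqP/eqP => -[/eqP]; rewrite (negbTE lk).
Qed.

Lemma unit_mulE k (i j : 'I_(n k)) X :
  (forall b, coef (mat_unit R (mk i j) ** X) (mk i b) = coef X (mk j b)) /\
  (forall l (a b : 'I_(n l)), mk a a != mk i i ->
     coef (mat_unit R (mk i j) ** X) (mk a b) = 0).
Proof.
split=> [b|l a b ai]; rewrite coefM.
  rewrite (bigD1 j) //= big1 => [|h hj]; rewrite coef_unit.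
    by rewrite eqxx mul1r addr0.
  by rewrite mk_inj (negbTE hj) andbF mul0r.
rewrite big1 // => h _; rewrite coef_unit; case: eqP => [e|]; last by rewrite mul0r.
have : row_idx (mk a h) = row_idx (mk i j) := congr1 row_idx e.
by move=> /eqP; rewrite /row_idx /= (negbTE ai).
Qed.

Lemma unit_compress k (i j i' j' : 'I_(n k)) X :
  mat_unit R (mk i j) ** X ** mat_unit R (mk i' j')
  = coef X (mk j i') *: mat_unit R (mk i j').
Proof.
apply: matAlgP => -[l [a b]]; rewrite -/(mk a b) coefZ coef_unit -amulA.
have [e1 e2] := unit_mulE i j (X ** mat_unit R (mk i' j')).
have [ai|ai] := eqVneq (mk a a) (mk i i); last first.
  rewrite e2 //; case: eqP => [e|]; last by rewrite mulr0.
  have : row_idx (mk a b) = row_idx (mk i j') := congr1 row_idx e.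
  by move=> /eqP; rewrite /row_idx /= (negbTE ai).
have lk : l = k by case: ai.
subst l; move/eqP: ai; rewrite mk_inj => /andP[/eqP-> _].
rewrite e1 mk_inj eqxx /= coefM (bigD1 i') //= big1 => [|h hi'].
  by rewrite coef_unit mk_inj eqxx addr0.
by rewrite coef_unit mk_inj (negbTE hi') mulr0.
Qed.

Lemma unitM k (i j l : 'I_(n k)) :
  mat_unit R (mk i j) ** mat_unit R (mk j l) = mat_unit R (mk i l).
Proof.
apply: matAlgP => -[p [a b]]; rewrite -/(mk a b).
have [e1 e2] := unit_mulE i j (mat_unit R (mk j l)).
have [ai|ai] := eqVneq (mk a a) (mk i i); last first.
  rewrite e2 // coef_unit; case: eqP => // e.
  have : row_idx (mk a b) = row_idx (mk i l) := congr1 row_idx e.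
  by move=> /eqP; rewrite /row_idx /= (negbTE ai).
have pk : p = k by case: ai.
subst p; move/eqP: ai; rewrite mk_inj => /andP[/eqP-> _].
by rewrite e1 !coef_unit !mk_inj !eqxx.
Qed.

Lemma unitM0 t u : col_idx t != row_idx u -> mat_unit R t ** mat_unit R u = 0.
Proof.
case: t => k [i j]; case: u => l [a b]; rewrite /col_idx /row_idx /= => ja.
rewrite -/(mk i j) -/(mk a b).
apply: matAlgP => -[p [c d]]; rewrite -/(mk c d) coef0 coefM big1 // => h _.
rewrite !coef_unit; case: eqP => [e|]; last by rewrite mul0r.
case: eqP => [e'|]; last by rewrite mulr0.
have : col_idx (mk c h) = col_idx (mk i j) := congr1 col_idx e.
have : row_idx (mk h d) = row_idx (mk a b) := congr1 row_idx e'.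
by rewrite /col_idx /row_idx /= => -> /esym/eqP; rewrite (negbTE ja).
Qed.

Lemma upper_coef X :
  upper_triangular X <-> forall t, ~~ up_idx t -> coef X t = 0.
Proof.
split=> [uX [k [i j]]|uX k i j ji].
  by rewrite /up_idx /= -ltnNge; apply: uX.
by apply: (uX (mk i j)); rewrite /up_idx /= -ltnNge.
Qed.

Lemma upper_unit t : upper_triangular (mat_unit R t) <-> up_idx t.
Proof.
split=> [/upper_coef u|u].
  apply: contraT => /u; rewrite coef_unit eqxx => /eqP; by rewrite oner_eq0.
apply/upper_coef => v; rewrite coef_unit; case: eqP => // ->; by rewrite u.
Qed.

Lemma upper_lin (c : C) X Y : upper_triangular X -> upper_triangular Y ->
  upper_triangular (c *: X + Y).
Proof.
move=> /upper_coef uX /upper_coef uY; apply/upper_coef => t tn.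
by rewrite coefD coefZ uX // uY // mulr0 addr0.
Qed.

Lemma upper_mul X Y : upper_triangular X -> upper_triangular Y ->
  upper_triangular (X ** Y).
Proof.
move=> uX uY k i j ji; rewrite -coefE coefM big1 // => h _.
have [hi|hi] := ltnP h i; first by rewrite coefE uX // mul0r.
by rewrite (coefE h j) uY ?mulr0 //; apply: leq_trans hi.
Qed.

Lemma upper0 : upper_triangular (0 : M).
Proof. by apply/upper_coef => t _; rewrite coef0. Qed.

(** Regularity presents the image of a unit as the sum of a sequence that may repeat units, so
    natural coefficients are what it gives directly. For partial isometries [nat_pisom] improves
    them to 0 or 1. *)
Definition nat_coef X := forall t, exists a : nat, coef X t = a%:R.

Lemma nat_coef_units (s : seq idx) : nat_coef (\sum_(u <- s) mat_unit R u).
Proof.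
move=> t; rewrite coef_sum (eq_bigr (fun u => (t == u)%:R)) => [|u _].
  by rewrite -natr_sum; eexists.
exact: coef_unit.
Qed.

Lemma nat_coef_sum (I : Type) (r : seq I) (a : I -> nat) (F : I -> M) :
  (forall i, nat_coef (F i)) -> nat_coef (\sum_(i <- r) (a i)%:R *: F i).
Proof.
move=> nF t; elim: r => [|i r [b IH]].
  by exists 0%N; rewrite big_nil coef0.
have [c ci] := nF i t; exists (a i * c + b)%N.
by rewrite big_cons coefD IH coefZ ci natrD natrM.
Qed.

Lemma nat_pisom X : nat_coef X -> X ** star X ** X = X ->
  [/\ forall t, coef X t = (coef X t != 0)%:R,
      forall t u, coef X t != 0 -> coef X u != 0 -> row_idx t = row_idx u -> t = u
    & forall t u, coef X t != 0 -> coef X u != 0 -> col_idx t = col_idx u -> t = u].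
Proof.
move=> /boolp.choice[a Xa] XX.
have XXk k : X k *m (map_mx conjC (X k))^T *m X k = X k.
  by move: XX => /ffunP/(_ k); rewrite !ffunE.
have Xak k i j : X k i j = (a (mk i j))%:R by rewrite -Xa.
have r1 k i := nat_sum_sq_le1 (nat_pisom_row (Xak k) (XXk k) i).
have c1 k i := nat_sum_sq_le1 (nat_pisom_col (Xak k) (XXk k) i).
have nz t : (coef X t != 0) = (a t != 0%N) by rewrite Xa pnatr_eq0.
split=> [[k [i j]]|[k [i j]] [l [i' j']]|[k [i j]] [l [i' j']]].
- rewrite nz Xa -/(mk i j); have [/(_ j)] := r1 k i.
  by case: (a _) => [|[|]].
- rewrite !nz -/(mk i j) -/(mk i' j') /row_idx /= => tn un e.
  have lk : k = l by case: e.
  subst l; move/eqP: e; rewrite mk_inj => /andP[/eqP e _].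
  by subst i'; have [_ /(_ j j' tn un)->] := r1 k i.
- rewrite !nz -/(mk i j) -/(mk i' j') /col_idx /= => tn un e.
  have lk : k = l by case: e.
  subst l; move/eqP: e; rewrite mk_inj => /andP[/eqP e _].
  by subst j'; have [_ /(_ i i' tn un)->] := c1 k j.
Qed.

End MatrixUnits.

Lemma closure_lipschitz (R : realType) (V W : normedModType R[i]) (f : V -> W)
    (c : R) (E : set V) (F : set W) :
  (forall x y, nm (f x - f y) <= c * nm (x - y)) -> closed F ->
  (forall x, E x -> F (f x)) -> forall x, closure E x -> F (f x).
Proof.
move=> fc cF EF x /closureP Ex; apply: closed_approx => // e e0.
have c1 : 0 < `|c| + 1 by rewrite ltr_pwDr.
have [y Ey xy] := Ex (e / (`|c| + 1)) ltac:(by rewrite divr_gt0).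
exists (f y); first exact: EF.
apply: le_lt_trans (fc x y) _; apply: (@le_lt_trans _ _ ((`|c| + 1) * nm (x - y))).
  by rewrite ler_wpM2r ?nm_ge0 //; have := ler_norm c; lra.
by rewrite mulrC -ltr_pdivlMr.
Qed.

(** * The inductive system inside its limit *)

Section System.
Variables (R : realType) (S : tafSystem R) (A : cstarAlgType R).
Variable incl : forall i, matAlg R (dims S i) -> A.
Arguments incl : clear implicits.
Hypothesis lim : is_cstar_limit incl.
Local Notation C := R[i].
Local Notation idx l := (mat_index (dims S l)).
Local Notation T := (taf_algebra incl).

(* Locked: comparing two matrix units by conversion is very slow. *)
Definition munit : forall l, idx l -> A :=
  locked (fun l (t : idx l) => incl l (mat_unit R t)).
Arguments munit {l} t.

Lemma munitE l (t : idx l) : munit t = incl l (mat_unit R t).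
Proof. by rewrite /munit -lock. Qed.

Definition rproj l (t : idx l) : A := munit (row_idx t).
Definition cproj l (t : idx l) : A := munit (col_idx t).

Lemma inclL l (c : C) X Y : incl l (c *: X + Y) = c *: incl l X + incl l Y.
Proof. by have [L _ _] := incl_star_hom lim l; apply: L. Qed.

Lemma inclM l X Y : incl l (X ** Y) = incl l X ** incl l Y.
Proof. by have [_ ->] := incl_star_hom lim l. Qed.

Lemma incl_star l X : incl l (star X) = star (incl l X).
Proof. by have [_ _ ->] := incl_star_hom lim l. Qed.

Lemma incl0 l : incl l 0 = 0.
Proof.
have := inclL 1 (0 : matAlg R (dims S l)) 0; rewrite !scale1r addr0.
by move/eqP; rewrite -subr_eq subrr eq_sym => /eqP.
Qed.

Lemma inclZ l (c : C) X : incl l (c *: X) = c *: incl l X.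
Proof. by rewrite -(addr0 (c *: X)) inclL incl0 addr0. Qed.

Lemma inclD l X Y : incl l (X + Y) = incl l X + incl l Y.
Proof. by rewrite -(scale1r X) inclL !scale1r. Qed.

Lemma incl_sum l (I : Type) (r : seq I) (P : pred I) F :
  incl l (\sum_(i <- r | P i) F i) = \sum_(i <- r | P i) incl l (F i).
Proof. exact: (big_morph (incl l) (@inclD l) (incl0 l)). Qed.

Lemma phi0 l : phi (0 : matAlg R (dims S l)) = 0.
Proof.
have [L _ _] := phi_star_hom S l; have := L 1 0 0; rewrite !scale1r addr0.
by move/eqP; rewrite -subr_eq subrr eq_sym => /eqP.
Qed.

Lemma phi_sum l (a : idx l -> C) (F : idx l -> matAlg R (dims S l)) :
  phi (\sum_t a t *: F t) = \sum_t a t *: phi (F t).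
Proof.
have [L _ _] := phi_star_hom S l.
apply: (big_rec2 (fun x y => phi x = y)) => [|t x y _ <-]; first exact: phi0.
by rewrite L.
Qed.

Lemma phi_nat_coef l (X : matAlg R (dims S l)) : nat_coef X -> nat_coef (phi X).
Proof.
move=> /boolp.choice[a Xa]; rewrite (mat_unit_sum X) phi_sum.
rewrite (eq_bigr (fun t => (a t)%:R *: phi (mat_unit R t))) => [|t _].
  apply: nat_coef_sum => t; have [s ->] := phi_regular t.
  exact: nat_coef_units.
by rewrite Xa.
Qed.

Lemma incl_lift m l (X : matAlg R (dims S m)) : (m <= l)%N ->
  exists Y : matAlg R (dims S l), [/\ incl l Y = incl m X,
    upper_triangular X -> upper_triangular Y & nat_coef X -> nat_coef Y].
Proof.
elim: l => [|l IH].
  by rewrite leqn0 => /eqP m0; subst m; exists X.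
rewrite leq_eqVlt => /predU1P[ml|/IH[Y [YX uY nY]]]; first by subst m; exists X.
exists (phi Y); split=> [|/uY /phi_upper //|/nY /phi_nat_coef //].
by rewrite incl_compat.
Qed.

Lemma munitM0 l (t u : idx l) : col_idx t != row_idx u -> munit t ** munit u = 0.
Proof. by move=> tu; rewrite !munitE -inclM unitM0 // incl0. Qed.

Lemma munitM l k (i j h : 'I_(dims S l k)) :
  munit (mk i j) ** munit (mk j h) = munit (mk i h).
Proof. by rewrite !munitE -inclM unitM. Qed.

Lemma star_munit l k (i j : 'I_(dims S l k)) : star (munit (mk i j)) = munit (mk j i).
Proof. by rewrite !munitE -incl_star star_unit. Qed.

Lemma munit_neq0 l (t : idx l) : munit t != 0.
Proof.
apply/eqP; rewrite munitE -(incl0 l) => /(incl_inj lim)/eqP.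
by rewrite (negbTE (mat_unit_neq0 R t)).
Qed.

Lemma rprojM l (t : idx l) : rproj t ** munit t = munit t.
Proof. by case: t => k [i j]; rewrite /rproj munitM. Qed.

Lemma munitMc l (t : idx l) : munit t ** cproj t = munit t.
Proof. by case: t => k [i j]; rewrite /cproj munitM. Qed.

Lemma star_rproj l (t : idx l) : star (rproj t) = rproj t.
Proof. by rewrite /rproj star_munit. Qed.

Lemma star_cproj l (t : idx l) : star (cproj t) = cproj t.
Proof. by rewrite /cproj star_munit. Qed.

Lemma rproj_idem l (t : idx l) : rproj t ** rproj t = rproj t.
Proof. by rewrite /rproj munitM. Qed.

Lemma cproj_idem l (t : idx l) : cproj t ** cproj t = cproj t.
Proof. by rewrite /cproj munitM. Qed.

Lemma munit_starM l (t : idx l) : munit t ** star (munit t) = rproj t.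
Proof. by case: t => k [i j]; rewrite star_munit munitM. Qed.

Lemma star_munitM l (t : idx l) : star (munit t) ** munit t = cproj t.
Proof. by case: t => k [i j]; rewrite star_munit munitM. Qed.

Lemma rproj_orth l (t u : idx l) : row_idx t != row_idx u -> rproj t ** rproj u = 0.
Proof. by move=> tu; apply: munitM0. Qed.

Lemma cproj_orth l (t u : idx l) : col_idx t != col_idx u -> cproj t ** cproj u = 0.
Proof. by move=> tu; apply: munitM0. Qed.

Lemma compress_incl l (t : idx l) X :
  rproj t ** incl l X ** cproj t = coef X t *: munit t.
Proof.
by rewrite /rproj /cproj !munitE -!inclM unit_compress -mk_tagged inclZ.
Qed.

Lemma nm_rproj l (t : idx l) : nm (rproj t) <= 1.
Proof. by rewrite nm_proj_le1 ?star_rproj ?rproj_idem. Qed.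

Lemma nm_cproj l (t : idx l) : nm (cproj t) <= 1.
Proof. by rewrite nm_proj_le1 ?star_cproj ?cproj_idem. Qed.

Lemma nm_munit l (t : idx l) : nm (munit t) = 1.
Proof.
have pt : munit t ** star (munit t) ** munit t = munit t.
  by rewrite munit_starM rprojM.
apply/eqP; rewrite eq_le nm_pisom_le1 //=.
have t0 : nm (munit t) != 0.
  by apply/eqP => /nm_eq0/eqP; rewrite (negbTE (munit_neq0 t)).
have {}t0 : 0 < nm (munit t) by rewrite lt_neqAle eq_sym t0 nm_ge0.
rewrite leNgt; apply/negP => t1.
have : nm (munit t) <= nm (munit t) * nm (munit t) * nm (munit t).
  rewrite -{1}pt; apply: le_trans (nm_amul _ _) _; rewrite ler_pM2r //.
  by apply: le_trans (nm_amul _ _) _; rewrite nm_star.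
by nra.
Qed.

Lemma nm_compress l (t : idx l) x : nm (rproj t ** x ** cproj t) <= nm x.
Proof.
apply: le_trans (nm_amul _ _) _; rewrite -(mulr1 (nm x)).
apply: ler_pM; rewrite ?nm_ge0 ?nm_cproj //.
apply: le_trans (nm_amul _ _) _; rewrite -{2}(mul1r (nm x)).
by rewrite ler_wpM2r ?nm_ge0 ?nm_rproj.
Qed.

Lemma nm_sum_compress l (B : pred (idx l)) (x : idx l -> A) M : 0 <= M ->
  (forall t u, B t -> B u -> row_idx t = row_idx u -> t = u) ->
  (forall t u, B t -> B u -> col_idx t = col_idx u -> t = u) ->
  (forall t, B t -> nm (x t) <= M) ->
  nm (\sum_(t | B t) rproj t ** x t ** cproj t) <= M.
Proof.
move=> M0 Br Bc xM; apply: nm_sum_orth => // [t u Bt Bu tu|t Bt]; last first.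
  exact: le_trans (nm_compress _ _) (xM t Bt).
apply: corner_orth; rewrite ?star_rproj ?star_cproj //.
  by apply: rproj_orth; apply: contra_neq tu => /Br; apply.
by apply: cproj_orth; apply: contra_neq tu => /Bc; apply.
Qed.

(* [sub_unit s u]: [u] is one of the matrix units of level [l] whose sum is the
   image of the matrix unit [s] of level [m <= l]. *)
Definition sub_unit m (s : idx m) l (u : idx l) : bool :=
  rproj u ** munit s ** cproj u != 0.

Lemma sub_unitE m (s : idx m) l (u : idx l) :
  sub_unit s u = (rproj u ** munit s ** cproj u != 0).
Proof. by []. Qed.

(** The image of a matrix unit is a partial isometry with natural coefficients, so [nat_pisom]
    applies. *)
Lemma sub_unitP m (s : idx m) l : (m <= l)%N ->
  exists X : matAlg R (dims S l), [/\ incl l X = munit s,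
    forall u : idx l, coef X u = (sub_unit s u)%:R,
    up_idx s -> upper_triangular X,
    forall t u : idx l, sub_unit s t -> sub_unit s u -> row_idx t = row_idx u -> t = u
  & forall t u : idx l, sub_unit s t -> sub_unit s u -> col_idx t = col_idx u -> t = u].
Proof.
move=> /(incl_lift (mat_unit R s))[X []]; rewrite -munitE => Xs uX nX; exists X.
have XX : X ** star X ** X = X.
  by apply: (incl_inj lim); rewrite !inclM incl_star Xs munit_starM rprojM.
have nXs : nat_coef X.
  apply: nX => t; rewrite coef_unit; exact: ex_intro.
have [X01 Xr Xc] := nat_pisom nXs XX.
have subX (u : idx l) : sub_unit s u = (coef X u != 0).
  by rewrite /sub_unit -[munit s]Xs compress_incl scaler_eq0 (negbTE (munit_neq0 u)) orbF.
split=> [//|u|us|t u|t u]; rewrite ?subX //.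
- by apply: uX; apply/upper_unit.
- exact: Xr.
- exact: Xc.
Qed.

Lemma sub_unit_row m (s : idx m) l (t u : idx l) : (m <= l)%N ->
  sub_unit s t -> sub_unit s u -> row_idx t = row_idx u -> t = u.
Proof. by move=> /(sub_unitP s)[X [_ _ _ r _]]; apply: r. Qed.

Lemma sub_unit_col m (s : idx m) l (t u : idx l) : (m <= l)%N ->
  sub_unit s t -> sub_unit s u -> col_idx t = col_idx u -> t = u.
Proof. by move=> /(sub_unitP s)[X [_ _ _ _ c]]; apply: c. Qed.

Lemma sub_unit_up m (s : idx m) l (u : idx l) : (m <= l)%N ->
  up_idx s -> sub_unit s u -> up_idx u.
Proof.
move=> /(sub_unitP s)[X [_ cX uX _ _]] /uX/upper_coef uX' su.
by apply: contraT => /uX'; rewrite cX su => /eqP; rewrite oner_eq0.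
Qed.

Lemma sub_unit_compress m (s : idx m) l (u : idx l) : (m <= l)%N ->
  rproj u ** munit s ** cproj u = (sub_unit s u)%:R *: munit u.
Proof. by move=> /(sub_unitP s)[X [<- cX _ _ _]]; rewrite compress_incl cX. Qed.

Lemma munit_sub_sum m (s : idx m) l : (m <= l)%N ->
  munit s = \sum_(u : idx l | sub_unit s u) munit u.
Proof.
move=> /(sub_unitP s)[X [<- cX _ _ _]]; rewrite (mat_unit_sum X) incl_sum.
rewrite [RHS]big_mkcond; apply: eq_bigr => u _; rewrite inclZ cX -munitE.
by case: ifP => _; rewrite ?scale1r ?scale0r.
Qed.

Lemma taf_incl l X : upper_triangular X -> T (incl l X).
Proof. by move=> uX; apply: subset_closure; exists l => //; exists X. Qed.

Lemma taf_munit l (t : idx l) : up_idx t -> T (munit t).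
Proof. by move=> ut; rewrite munitE; apply/taf_incl/upper_unit. Qed.

Lemma taf_rproj l (t : idx l) : T (rproj t).
Proof. by apply: taf_munit; rewrite /up_idx /= leqnn. Qed.

Lemma taf_cproj l (t : idx l) : T (cproj t).
Proof. by apply: taf_munit; rewrite /up_idx /= leqnn. Qed.

Lemma taf_subspace : closed_subspace T.
Proof.
apply: closed_subspaceP => [|c x y [m _ [X uX <-]] [l _ [Y uY <-]]].
  by exists 0%N => //; exists 0; [exact: upper0 | exact: incl0].
have [X' [<- /(_ uX) uX' _]] := incl_lift X (leq_maxl m l).
have [Y' [<- /(_ uY) uY' _]] := incl_lift Y (leq_maxr m l).
exists (maxn m l) => //; exists (c *: X' + Y'); last exact: inclL.
exact: upper_lin.
Qed.

Lemma taf_closed : closed T.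
Proof. by case: taf_subspace. Qed.

Lemma closure_amul (E F : set A) x y : closed F ->
  (forall x y, E x -> E y -> F (x ** y)) -> closure E x -> closure E y -> F (x ** y).
Proof.
move=> cF EF Ex Ey.
apply: (@closure_lipschitz _ _ _ (fun x : A => x ** y) (nm y) E) => // [a b|a Ea].
  by rewrite -amulBl mulrC nm_amul.
apply: (@closure_lipschitz _ _ _ (amul a) (nm a) E) => // [b c|b Eb].
  by rewrite -amulBr nm_amul.
exact: EF.
Qed.

Lemma taf_mul x y : T x -> T y -> T (x ** y).
Proof.
apply: closure_amul taf_closed _ => {}x {}y [m _ [X uX <-]] [l _ [Y uY <-]].
have [X' [<- /(_ uX) uX' _]] := incl_lift X (leq_maxl m l).
have [Y' [<- /(_ uY) uY' _]] := incl_lift Y (leq_maxr m l).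
by rewrite -inclM; apply/taf_incl/upper_mul.
Qed.

Lemma taf_approx x (e : R) : T x -> 0 < e -> exists m, forall l, (m <= l)%N ->
  exists2 X, upper_triangular X & nm (x - incl l X) < e.
Proof.
move=> /closureP Tx e0; have [_ [m _ [X uX <-]] xX] := Tx e e0.
exists m => l ml; have [Y [YX /(_ uX) uY _]] := incl_lift X ml.
by exists Y; rewrite // YX.
Qed.

Lemma taf_diagonal l (t : idx l) : row_idx t = col_idx t ->
  alg_diagonal T (munit t).
Proof.
case: t => k [i j] /eqP; rewrite /row_idx /col_idx mk_inj /= => /andP[/eqP ij _].
subst j; have Tt : T (munit (mk i i)) by apply: taf_munit; rewrite /up_idx /= leqnn.
by split=> //; exists (munit (mk i i)); rewrite // star_munit.
Qed.

Section Ideal.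
Variable K : set A.
Hypothesis idK : closed_ideal T K.

Lemma ideal_subspace : closed_subspace K. Proof. by case: idK. Qed.

Lemma ideal_mul x y z : T x -> K y -> T z -> K (x ** y ** z).
Proof.
case: idK => _ _ KM Tx Ky Tz.
have [Kxy _] := KM x y Tx Ky.
by have [_] := KM z _ Tz Kxy.
Qed.

(* If [y] in [K] is at distance less than 1 from [s] then a good approximant of
   [y] at a high level has coefficients bounded away from 0 at all the sub-units
   of [s]; dividing by them approximates [s] from inside [K]. *)
Lemma ideal_munit_dist m (s : idx m) y : K y -> nm (munit s - y) < 1 -> K (munit s).
Proof.
move=> Ky sy1; have [KT [cK _ _] _] := idK.
apply: closed_approx => // e e0.
(* The distance from [munit s] to [y] is [1 - 2 * d]. An approximant of [y] within
   [d * (e / (1 + e))] therefore has coefficients of modulus at least [d] at the sub-units of [s],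
   and dividing by them leaves an error of at most [e / (1 + e)], a number below both 1 and [e]. *)
pose d := (1 - nm (munit s - y)) / 2.
have d0 : 0 < d by rewrite /d divr_gt0 //; lra.
have e1 : 0 < e / (1 + e) by rewrite divr_gt0 //; lra.
have e1e : e / (1 + e) < e by rewrite ltr_pdivrMr; nra.
have e11 : e / (1 + e) < 1 by rewrite ltr_pdivrMr; lra.
have [n nP] := taf_approx (KT _ Ky) (mulr_gt0 d0 e1).
pose l := maxn m n; have ml : (m <= l)%N := leq_maxl _ _.
have [Y uY yY] := nP l (leq_maxr _ _).
pose B (u : idx l) := sub_unit s u.
have cB u : B u -> d <= nm (coef Y u : C^o).
  move=> Bu; have us : rproj u ** munit s ** cproj u = munit u.
    by rewrite sub_unit_compress // [sub_unit _ _]Bu scale1r.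
  have := nm_compress u (munit s - incl l Y).
  rewrite amulBr amulBl us compress_incl -{1}(scale1r (munit u)) -scalerBl.
  rewrite nmZ nm_munit mulr1 => c1.
  have c2 : nm (munit s - incl l Y) <= nm (munit s - y) + nm (y - incl l Y).
    by apply: le_trans (nmD _ _); rewrite addrA subrK.
  have c3 : nm (1 : C^o) <= nm (1 - coef Y u : C^o) + nm (coef Y u : C^o).
    by apply: le_trans (nmD _ _); rewrite subrK.
  have c4 : nm (1 : C^o) = 1 by rewrite /nm normr1.
  have c5 : nm (munit s - y) = 1 - 2 * d by rewrite /d; lra.
  by rewrite c4 in c3; nra.
have cB0 u : B u -> coef Y u != 0.
  by move=> /cB; apply: contraTneq => ->; rewrite nm0 -ltNge.
exists (\sum_(u | B u) (coef Y u)^-1 *: (rproj u ** y ** cproj u)).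
  apply: subspace_sum ideal_subspace _ => u _; apply: subspaceZ ideal_subspace _.
  by apply: ideal_mul => //; [exact: taf_rproj | exact: taf_cproj].
rewrite (munit_sub_sum s ml) -sumrB.
rewrite (eq_bigr (fun u => rproj u ** ((coef Y u)^-1 *: (incl l Y - y)) ** cproj u)).
  apply: le_lt_trans e1e; apply: nm_sum_compress => [|t u|t u|u Bu].
  - exact: ltW.
  - exact: sub_unit_row.
  - exact: sub_unit_col.
  - rewrite nmZ nmBC.
    have -> : nm ((coef Y u)^-1 : C^o) = (nm (coef Y u : C^o))^-1.
      by rewrite /nm normfV normE -fmorphV.
    rewrite ler_pdivrMl; last exact: lt_le_trans (cB u Bu).
    apply: le_trans (ltW yY) _; rewrite ler_wpM2r //; [exact: ltW|exact: cB].
move=> u Bu; rewrite amulZr amulZl amulBr amulBl scalerBr compress_incl scalerA.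
by rewrite mulVf ?scale1r // cB0.
Qed.

End Ideal.
End System.

(** * Closed ideals are determined by their matrix units *)

Section Inductive.
Variables (R : realType) (S : tafSystem R) (A : cstarAlgType R).
Variable incl : forall i, matAlg R (dims S i) -> A.
Arguments incl : clear implicits.
Hypothesis lim : is_cstar_limit incl.
Local Notation C := R[i].
Local Notation idx l := (mat_index (dims S l)).
Local Notation T := (taf_algebra incl).
Local Notation munit := (@munit R S A incl _).
Local Notation rproj := (@rproj R S A incl _).
Local Notation cproj := (@cproj R S A incl _).
Local Notation sub_unit s u := (sub_unit incl s u).

Lemma munitMsub m (s : idx m) l (u : idx l) : (m <= l)%N -> sub_unit s u ->
  munit s ** cproj u = munit u.
Proof.
move=> ml su; rewrite (munit_sub_sum lim s ml) amul_suml (bigD1 u) //=.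
rewrite (munitMc lim) big1 ?addr0 // => v /andP[sv vu].
apply: (munitM0 lim); apply: contra_neq vu => e.
by apply: (sub_unit_col lim ml sv su); rewrite e.
Qed.

Lemma sub_munitM m (s : idx m) l (u : idx l) : (m <= l)%N -> sub_unit s u ->
  rproj u ** munit s = munit u.
Proof.
move=> ml su; rewrite (munit_sub_sum lim s ml) amul_sumr (bigD1 u) //=.
rewrite (rprojM lim) big1 ?addr0 // => v /andP[sv vu].
apply: (munitM0 lim); apply: contra_neq vu => e.
by apply: (sub_unit_row lim ml sv su); rewrite -e.
Qed.

(** A diagonal unit is self-adjoint, so the adjoint of a sub-unit is again a sub-unit; both are
    upper triangular, which forces row and column to agree. *)
Lemma sub_unit_diag m (s : idx m) l (u : idx l) : (m <= l)%N ->
  row_idx s = col_idx s -> sub_unit s u -> row_idx u = col_idx u.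
Proof.
case: s => k [i j]; rewrite -/(mk i j) /row_idx /col_idx => ml /eqP.
rewrite mk_inj /= => /andP[/eqP ij _] su; subst j.
have us : up_idx (mk i i) by rewrite /up_idx /= leqnn.
case: u su => q [a b]; rewrite -/(mk a b) => su.
have su' : sub_unit (mk i i) (mk b a).
  move: su; rewrite !sub_unitE; apply: contraNN => /eqP.
  move/(congr1 (@star R A)); rewrite star0 !starM.
  rewrite (star_rproj lim) (star_cproj lim) (star_munit lim) amulA => e.
  by apply/eqP; rewrite /rproj /cproj /row_idx /col_idx /= in e *.
have := sub_unit_up lim ml us su; have := sub_unit_up lim ml us su'.
rewrite /up_idx /= => ba ab; suff -> : a = b by [].
by apply/val_inj/eqP; rewrite eqn_leq ab.
Qed.

(** If no sub-unit of [s] had its column at [f], then [munit s ** munit f] would vanish; multiplying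
    by [star (munit s)] would give [munit f = 0]. *)
Lemma munit_descend m (s : idx m) l (f : idx l) : (m <= l)%N ->
  row_idx f = col_idx f -> cproj s ** munit f = munit f ->
  exists2 u : idx l, munit s ** munit f = munit u & col_idx u = col_idx f.
Proof.
move=> ml ff sf.
have [|no] := pselect (exists2 u : idx l, sub_unit s u & col_idx u = row_idx f).
  move=> [u su uf]; exists u; last by rewrite uf.
  rewrite -(munitMsub ml su) /cproj uf ff.
  by congr (_ ** _); case: f ff {sf uf} => k [i j] /eqP; rewrite mk_inj /= => /andP[/eqP-> _].
have : munit s ** munit f = 0.
  rewrite (munit_sub_sum lim s ml) amul_suml big1 // => u su.
  by apply: (munitM0 lim); apply/eqP => uf; apply: no; exists u.
move/(congr1 (amul (star (munit s)))); rewrite amul0r amulA (star_munitM lim) sf.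
by move/eqP; rewrite (negbTE (munit_neq0 lim f)).
Qed.

(** * Pinching from a higher level *)

Section Pinching.
Variables (m l : nat).
Hypothesis ml : (m <= l)%N.

(** Position 0 of each block serves as base point: the corner [z b] is cut into its sub-units [f] of
    level [l], and the units [mk i (i0 b)] carry [f] to the other positions. *)
Let i0 (b : 'I_(blocks S m)) : 'I_(dims S m b) := Ordinal (dims_gt0 b).
Let z b : idx m := mk (i0 b) (i0 b).
Let g b (f : idx l) (i : 'I_(dims S m b)) : A := munit (mk i (i0 b)) ** munit f.
Let P (bf : 'I_(blocks S m) * idx l) := sub_unit (z bf.1) bf.2.
(** Copies of [f] at all diagonal positions of block [b] are added up; this makes the sum commute
    with level [m]. *)
Let p (bf : 'I_(blocks S m) * idx l) :=
  \sum_i g bf.2 i ** star (@g bf.1 bf.2 i).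

Let z_diag b f : P (b, f) -> row_idx f = col_idx f.
Proof. exact: sub_unit_diag. Qed.

Let star_f b f : P (b, f) -> star (munit f) = munit f.
Proof.
move/z_diag; case: f => k [i j] /eqP; rewrite mk_inj /= => /andP[/eqP ij _].
by subst j; rewrite (star_munit lim).
Qed.

Let ff b f : P (b, f) -> munit f ** munit f = munit f.
Proof.
move/z_diag; case: f => k [i j] /eqP; rewrite mk_inj /= => /andP[/eqP ij _].
by subst j; rewrite (munitM lim).
Qed.

Let zf b f : P (b, f) -> munit (z b) ** munit f = munit f.
Proof.
by move=> Pf; rewrite -(munitMsub ml Pf) amulA (munitM lim).
Qed.

Let gg b f i j : P (b, f) -> 
  star (@g b f i) ** g f j = (i == j)%:R *: munit f.
Proof.
move=> Pf; rewrite starM (star_f Pf) (star_munit lim) !amulA -(amulA (munit f)).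
have [<-|ij] := eqVneq i j.
  by rewrite (munitM lim) scale1r -amulA (zf Pf) (ff Pf).
rewrite (munitM0 lim) ?amul0r ?amul0l ?scale0r // /col_idx /row_idx mk_inj /=.
by rewrite (negbTE ij).
Qed.

Let gg0 b f b' f' i j : P (b, f) -> P (b', f') -> (b, f) != (b', f') ->
  star (@g b f i) ** @g b' f' j = 0.
Proof.
move=> Pf Pf' bf; rewrite starM (star_f Pf) (star_munit lim) !amulA -(amulA (munit f)).
have [bb|bb] := eqVneq b b'; last first.
  rewrite (munitM0 lim) ?amul0r ?amul0l // /col_idx /row_idx /=.
  by apply/eqP => -[/eqP]; rewrite (negbTE bb).
subst b'; have {}bf : f != f' by apply: contra_neq bf => ->.
have [ij|ij] := eqVneq i j.
  subst j; rewrite (munitM lim) -amulA (zf Pf') (munitM0 lim) //.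
  rewrite -(z_diag Pf); apply: contra_neq bf.
  move: (z_diag Pf) (z_diag Pf') => {Pf Pf'}.
  case: f => q [a c] /eqP; rewrite mk_inj /= => /andP[/eqP ac _].
  case: f' => q' [a' c'] /eqP; rewrite mk_inj /= => /andP[/eqP ac' _].
  by subst c c'.
rewrite (munitM0 lim) ?amul0r ?amul0l // /col_idx /row_idx mk_inj /=.
by rewrite (negbTE ij).
Qed.

Let p_star bf : star (p bf) = p bf.
Proof. by rewrite star_sum; apply: eq_bigr => i _; rewrite starM starK. Qed.

Let gf b f i : P (b, f) -> @g b f i ** munit f = g f i.
Proof. by move=> Pf; rewrite /g -amulA (ff Pf). Qed.

Let pp bf : P bf -> p bf ** p bf = p bf.
Proof.
case: bf => b f Pf; rewrite {1}/p amul_suml; apply: eq_bigr => i _ /=.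
rewrite amul_sumr (bigD1 i) //= big1 => [|j ji].
  by rewrite addr0 amulA -(amulA (g f i)) (gg _ _ Pf) eqxx scale1r (gf _ Pf).
by rewrite amulA -(amulA (g f i)) (gg _ _ Pf) eq_sym (negbTE ji) scale0r amul0r amul0l.
Qed.

Let pp0 bf bf' : P bf -> P bf' -> bf != bf' -> p bf ** p bf' = 0.
Proof.
case: bf bf' => [b f] [b' f'] Pf Pf' bf.
rewrite {1}/p amul_suml big1 // => i _; rewrite amul_sumr big1 // => j _ /=.
by rewrite amulA -(amulA (g f i)) gg0 // amul0r amul0l.
Qed.

Let Q x := \sum_(bf | P bf) p bf ** x ** p bf.

Let nm_Q x : nm (Q x) <= nm x.
Proof.
have p1 bf : P bf -> nm (p bf) <= 1 by move=> Pf; apply: nm_proj_le1 (p_star _) (pp Pf).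
apply: nm_sum_orth => [|bf bf' Pf Pf' fbf|bf Pf]; first exact: nm_ge0.
  by apply: corner_orth; rewrite ?p_star ?pp0.
apply: le_trans (nm_amul _ _) _; rewrite -(mulr1 (nm x)).
apply: ler_pM; rewrite ?nm_ge0 ?p1 //.
apply: le_trans (nm_amul _ _) _; rewrite -{2}(mul1r (nm x)).
by rewrite ler_wpM2r ?nm_ge0 ?p1.
Qed.

Let G (s : idx m) f := g f (tagged s).1 ** star (@g (tag s) f (tagged s).1).
Let G' (s : idx m) f := g f (tagged s).2 ** star (@g (tag s) f (tagged s).2).

(** Expanding both factors [p] produces the corners between the copies of [f] at two positions.
    Sorting them by the matrix unit of level [m] gives a number of families that does not depend on
    [l]. *)
Let QE x : Q x = \sum_(s : idx m) \sum_(f | P (tag s, f)) G s f ** x ** G' s f.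
Proof.
transitivity (\sum_b \sum_(ij : 'I_(dims S m b) * 'I_(dims S m b))
    \sum_(f | P (b, f)) g f ij.1 ** star (@g b f ij.1) ** x
      ** (g f ij.2 ** star (@g b f ij.2))); last first.
  by rewrite sig_big_dep.
rewrite /Q (eq_bigl (fun bf => xpredT bf.1 && P (bf.1, bf.2))); last by case.
rewrite (eq_bigr (fun bf => p (bf.1, bf.2) ** x ** p (bf.1, bf.2))); last by case.
rewrite -(pair_big_dep xpredT (fun b f => P (b, f))
  (fun b f => p (b, f) ** x ** p (b, f))) /=.
apply: eq_bigr => b _; rewrite [RHS]exchange_big /=; apply: eq_bigr => f _.
rewrite -(pair_bigA _ (fun i j => g f i ** star (@g b f i) ** x
  ** (g f j ** star (@g b f j)))) /=.
rewrite {1}/p /= !amul_suml; apply: eq_bigr => i _.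
by rewrite amul_sumr.
Qed.

Let Q_incl X : Q (incl m X) = incl m X.
Proof.
rewrite QE [RHS](congr1 (incl m) (mat_unit_sum X)) (incl_sum lim).
apply: eq_bigr => -[b [i j]] _; rewrite /G /G' /= (inclZ lim) -munitE.
rewrite (eq_bigr (fun f => coef X (mk i j) *:
    (munit (mk i (i0 b)) ** munit f ** munit (mk (i0 b) j)))) => [|f Pf].
  rewrite -scaler_sumr -amul_suml -amul_sumr.
  by rewrite -(munit_sub_sum lim (z b) ml) !(munitM lim).
rewrite amulA -(amulA (g f i)) -(amulA (g f i)).
have -> : star (g f i) ** incl m X ** g f j = coef X (mk i j) *: munit f.
  rewrite starM (star_f Pf) (star_munit lim) !amulA -!(amulA (munit f)).
  have -> : munit (mk (i0 b) i) ** incl m X ** munit (mk j (i0 b))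
    = coef X (mk i j) *: munit (z b).
    by rewrite !munitE -!(inclM lim) unit_compress (inclZ lim).
  by rewrite amulZl amulZr (zf Pf) (ff Pf).
rewrite amulZr amulZl (gf _ Pf) /g starM (star_f Pf) (star_munit lim).
by rewrite amulA -(amulA _ (munit f) (munit f)) (ff Pf).
Qed.

(** The two copies of [f] are the range projections of units with a common column, and [v] joins
    their rows. It need not be upper triangular. *)
Let GE (s : idx m) f : P (tag s, f) ->
  exists2 v : idx l, G s f = rproj v & G' s f = cproj v.
Proof.
case: s => b [i j] Pf; rewrite /G /G' /=.
have H (i' : 'I_(dims S m b)) : exists2 u : idx l, g f i' = munit u & col_idx u = col_idx f.
  exact: (munit_descend (s := mk i' (i0 b)) ml (z_diag Pf) (zf Pf)).
have [[q [r1 c1]] g1 u1] := H i; have [[q' [r2 c2]] g2 u2] := H j.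
have qq : q = q' by move: u1; rewrite -u2 => -[].
subst q'; have /eqP : col_idx (mk r1 c1) = col_idx (mk r2 c2) by rewrite u1 u2.
rewrite mk_inj /= => /andP[/eqP cc _]; subst c2.
by exists (mk r1 r2); rewrite ?g1 ?g2 (munit_starM lim).
Qed.

Let G_orth (s : idx m) f f' : P (tag s, f) -> P (tag s, f') -> f != f' ->
  G s f ** G s f' = 0 /\ G' s f ** G' s f' = 0.
Proof.
move=> Pf Pf' neq; have bf : (tag s, f) != (tag s, f').
  by apply: contra_neq neq => -[].
rewrite /G /G'; split.
  by rewrite amulA -(amulA (g f _)) gg0 // amul0r amul0l.
by rewrite amulA -(amulA (g f _)) gg0 // amul0r amul0l.
Qed.

(* [Q] is the pinching by the minimal projections of the diagonal of level [l]
   that commute with level [m]. It is contractive and fixes level [m], and it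
   involves at most [#|idx m|] families of orthogonal corners, whatever [l]. *)
Lemma pinching_dist (J : set A) (X : matAlg R (dims S m)) x e d :
  closed_ideal T J -> 0 <= d -> nm (x - incl m X) <= e ->
  (forall v : idx l, exists2 j, J j &
     nm (rproj v ** x ** cproj v - rproj v ** j ** cproj v) <= d) ->
  exists2 j, J j & nm (x - j) <= 2 * e + #|{: idx m}|%:R * d.
Proof.
move=> idJ d0 xX near.
have H (sf : idx m * idx l) : exists j, P (tag sf.1, sf.2) ->
    J j /\ nm (G sf.1 sf.2 ** x ** G' sf.1 sf.2 - j) <= d /\
    j = G sf.1 sf.2 ** j ** G' sf.1 sf.2.
  have [Pf|?] := boolP (P (tag sf.1, sf.2)); last by exists 0.
  have [v -> ->] := GE Pf; have [j Jj jd] := near v.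
  (* Compressing [j] keeps it in [J] and makes the differences below orthogonal corners. *)
  exists (rproj v ** j ** cproj v) => _; split.
    by apply: (ideal_mul idJ) => //; [exact: taf_rproj|exact: taf_cproj].
  split=> //.
  by rewrite !amulA (rproj_idem lim) -(amulA _ (cproj v)) (cproj_idem lim).
have [jf jP] := boolp.choice H.
exists (\sum_(s : idx m) \sum_(f | P (tag s, f)) jf (s, f)).
  apply: subspace_sum (ideal_subspace idJ) _ => s _.
  apply: subspace_sum (ideal_subspace idJ) _ => f Pf.
  by have [] := jP (s, f) Pf.
(* Since [Q] fixes [incl m X], the error splits into two terms of norm at most [e] and a difference
   of corners, which costs [d] for each unit of level [m]. *)
have -> : x - \sum_(s : idx m) \sum_(f | P (tag s, f)) jf (s, f) =
    (x - incl m X) + Q (incl m X - x) +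
    (Q x - \sum_(s : idx m) \sum_(f | P (tag s, f)) jf (s, f)).
  have -> : Q (incl m X - x) = Q (incl m X) - Q x.
    by rewrite /Q -sumrB; apply: eq_bigr => bf _; rewrite amulBr amulBl.
  rewrite Q_incl [RHS]addrA; congr (_ - _).
  by rewrite -addrA subrK subrK.
apply: le_trans (nmD _ _) _; apply: lerD.
  rewrite mulr2n mulrDl mul1r; apply: le_trans (nmD _ _) _; apply: lerD => //.
  by apply: le_trans (nm_Q _) _; rewrite nmBC.
rewrite QE -sumrB; apply: le_trans (nm_sum _ _ _) _.
rewrite -sum1_card natr_sum mulr_suml; apply: ler_sum => s _; rewrite mul1r.
rewrite -sumrB; apply: nm_sum_orth => // [f f' Pf Pf' neq|f Pf]; last first.
  by have [_ []] := jP (s, f) Pf.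
have [_ [_ /= ->]] := jP (s, f) Pf; have [_ [_ /= ->]] := jP (s, f') Pf'.
rewrite -!amulBl -!amulBr.
have [G0 G'0] := G_orth Pf Pf' neq.
by apply: corner_orth => //; rewrite starM starK.
Qed.

End Pinching.

Lemma ideal_inductive (K J : set A) : closed_ideal T K -> closed_ideal T J ->
  (forall l (t : idx l), up_idx t -> K (munit t) -> J (munit t)) -> K `<=` J.
Proof.
move=> idK idJ KJ x Kx; have [KT _ _] := idK.
have [cJ J0 _] := ideal_subspace idJ.
apply: closed_approx => // e e0.
have e4 : 0 < e / 4 by lra.
have [m /(_ m (leqnn m)) [X uX xX]] := taf_approx lim (KT _ Kx) e4.
pose N : R := #|{: idx m}|%:R; have N0 : 0 <= N := ler0n _ _.
(* The order of choices matters: [m] and with it [N] come first, then the tolerance [h], then the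
   higher level. With an error [2 * h] per corner the total [2 * (e / 4) + N * (2 * h)] stays below
   [e]. *)
pose h := e / 8 / (N + 1).
have h0 : 0 < h by rewrite divr_gt0 //; lra.
have [n nP] := taf_approx lim (KT _ Kx) h0.
have [Y uY xY] := nP (maxn m n) (leq_maxr m n).
have near (v : idx (maxn m n)) : exists2 j, J j &
    nm (rproj v ** x ** cproj v - rproj v ** j ** cproj v) <= 2 * h.
  pose c := coef Y v.
  have xc : nm (rproj v ** x ** cproj v - c *: munit v) <= h.
    rewrite -(compress_incl lim) -amulBl -amulBr.
    exact: le_trans (nm_compress lim _ _) (ltW xY).
  (* A large coefficient brings the normalized corner of [x] closer than 1 to [munit v], so this
     unit lies in [K], hence in [J]; a small one makes the whole corner negligible. *)
  have [c0|c0] := ltP h (nm (c : C^o)).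
    exists (c *: munit v); last first.
      rewrite amulZr amulZl (rprojM lim) (munitMc lim); apply: le_trans xc _; lra.
    apply: subspaceZ (ideal_subspace idJ) _; apply: KJ.
      apply: contraT; move/upper_coef: uY => /[apply]; rewrite -/c => c00.
      by move: c0; rewrite c00 nm0 ltNge ltW.
    apply: (ideal_munit_dist lim idK (y := c^-1 *: (rproj v ** x ** cproj v))).
      apply: subspaceZ (ideal_subspace idK) _; apply: (ideal_mul idK) => //.
        exact: taf_rproj.
      exact: taf_cproj.
    have cn0 : c != 0.
      by apply: contraTneq c0 => ->; rewrite nm0 -leNgt ltW.
    rewrite -[munit v](scalerK cn0) -scalerBr nmZ nmBC.
    have -> : nm (c^-1 : C^o) = (nm (c : C^o))^-1.
      by rewrite /nm normfV normE -fmorphV.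
    by rewrite ltr_pdivrMl ?(lt_trans h0) // mulr1 (le_lt_trans xc).
  exists 0 => //; rewrite amul0r amul0l subr0.
  apply: le_trans (_ : nm (c *: munit v) + h <= _); last first.
    by rewrite nmZ (nm_munit lim) mulr1; lra.
  rewrite -[rproj v ** _ ** _](subrK (c *: munit v)) addrC.
  by apply: le_trans (nmD _ _) _; rewrite lerD2l.
have [| |v|j Jj xj] := @pinching_dist _ _ (leq_maxl m n) J X x (e / 4) (2 * h) idJ.
- lra.
- exact: ltW.
- exact: near.
exists j => //; apply: le_lt_trans xj _.
suff : N * h < e / 8 by rewrite -/N; lra.
have -> : e / 8 = (N + 1) * h by rewrite /h [RHS]mulrC divfK // lt0r_neq0 //; lra.
by rewrite ltr_pM2r //; lra.
Qed.

End Inductive.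

(** * Successors of closed ideals *)

Section MinimalIdeal.
Variables (R : realType) (S : tafSystem R) (A : cstarAlgType R).
Variable incl : forall i, matAlg R (dims S i) -> A.
Arguments incl : clear implicits.
Hypothesis lim : is_cstar_limit incl.
Local Notation C := R[i].
Local Notation idx l := (mat_index (dims S l)).
Local Notation T := (taf_algebra incl).
Local Notation munit := (@munit R S A incl _).
Local Notation rproj := (@rproj R S A incl _).
Local Notation cproj := (@cproj R S A incl _).
Local Notation sub_unit s u := (sub_unit incl s u).

(** This holds exactly when [u] is obtained from [v] by multiplying with upper triangular units on
    both sides, so that every ideal containing [v] contains [u]. *)
Definition above l (v u : idx l) : bool :=
  [&& tag v == tag u, (tagged u).1 <= (tagged v).1
    & (tagged v).2 <= (tagged u).2]%N.

Lemma above_refl l (u : idx l) : above u u.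
Proof. by rewrite /above eqxx !leqnn. Qed.

Lemma aboveP l k (i j : 'I_(dims S l k)) (v : idx l) : above v (mk i j) ->
  exists a b : 'I_(dims S l k), [/\ v = mk a b, (i <= a)%N & (b <= j)%N].
Proof.
case: v => q [a b] /and3P[/= /eqP qk]; subst q => ia bj.
by exists a, b.
Qed.

Lemma idx_eq l (t u : idx l) : row_idx t = row_idx u -> col_idx t = col_idx u ->
  t = u.
Proof.
case: t => k [i j]; case: u => q [a b]; rewrite /row_idx /col_idx /= => e1.
have kq : k = q by case: e1.
subst q; move: e1 => /eqP; rewrite mk_inj => /andP[/eqP-> _] /eqP.
by rewrite mk_inj => /andP[/eqP-> _].
Qed.

Lemma sub_unit_inj m (s t : idx m) l (u : idx l) : (m <= l)%N ->
  sub_unit s u -> sub_unit t u -> s = t.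
Proof.
move=> ml su tu; apply: idx_eq; apply/eqP; apply: contraT => ne.
  have us : rproj s ** munit u = munit u.
    by rewrite -(munitMsub lim ml su) amulA (rprojM lim).
  have ut : rproj t ** munit u = munit u.
    by rewrite -(munitMsub lim ml tu) amulA (rprojM lim).
  have := munit_neq0 lim u; rewrite -us -ut amulA (rproj_orth lim) //.
  by rewrite amul0l eqxx.
have us : munit u ** cproj s = munit u.
  by rewrite -(sub_munitM lim ml su) -amulA (munitMc lim).
have ut : munit u ** cproj t = munit u.
  by rewrite -(sub_munitM lim ml tu) -amulA (munitMc lim).
have := munit_neq0 lim u; rewrite -ut -us -amulA (cproj_orth lim) //.
by rewrite amul0r eqxx.
Qed.

Section Generated.
Variable J : set A.
Hypothesis idJ : closed_ideal T J.
Variables (m : nat) (t : idx m).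
Hypothesis ut : up_idx t.

Definition above_sub l (X : matAlg R (dims S l)) : Prop :=
  upper_triangular X /\
  forall u, coef X u != 0 -> exists2 v : idx l, sub_unit t v & above v u.

(** An explicit form of the closed ideal generated by [J] and [munit t]: modulo [J], approximation
    by matrices supported where the sub-units of [t] generate. Asking for all levels past [l0]
    allows two elements to be compared at a common level. *)
Definition approx_gen (x : A) : Prop :=
  T x /\ forall e : R, 0 < e -> exists l0, forall l, (l0 <= l)%N ->
    exists j, J j /\ exists X, @above_sub l X /\ nm (x - j - incl l X) < e.

Let above_sub0 l : @above_sub l 0.
Proof. by split; [exact: upper0 | move=> u; rewrite coef0 eqxx]. Qed.

Let above_subL l (c : C) X Y :
  @above_sub l X -> @above_sub l Y -> @above_sub l (c *: X + Y).
Proof.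
move=> [uX aX] [uY aY]; split; first exact: upper_lin.
move=> u; rewrite coefD coefZ; have [X0|/aX //] := eqVneq (coef X u) 0.
by rewrite X0 mulr0 add0r; apply: aY.
Qed.

Let above_subM l X Y : upper_triangular Y -> @above_sub l X ->
  @above_sub l (Y ** X) /\ @above_sub l (X ** Y).
Proof.
move=> uY [uX aX]; split; (split; first exact: upper_mul) => -[k [i j]];
  rewrite -/(mk i j) coefM => ne.
  have [h] : exists h, coef Y (mk i h) * coef X (mk h j) != 0.
    apply/existsP; apply: contraR ne; rewrite negb_exists => /forallP H.
    by apply/eqP/big1 => h _; apply/eqP; move: (H h); rewrite negbK.
  rewrite mulf_eq0 negb_or => /andP[Yih /aX[v tv]].
  move=> /aboveP[a [b [ve ha bj]]]; exists v => //; rewrite ve.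
  rewrite /above /= eqxx bj andbT; apply: leq_trans ha.
  by apply: contraR Yih => hi; move/upper_coef: uY => ->.
have [h] : exists h, coef X (mk i h) * coef Y (mk h j) != 0.
  apply/existsP; apply: contraR ne; rewrite negb_exists => /forallP H.
  by apply/eqP/big1 => h _; apply/eqP; move: (H h); rewrite negbK.
rewrite mulf_eq0 negb_or => /andP[/aX[v tv] + Yhj].
move=> /aboveP[a [b [ve ia bh]]]; exists v => //; rewrite ve.
rewrite /above /= eqxx ia /=; apply: leq_trans bh _.
by apply: contraR Yhj => hi; move/upper_coef: uY => ->.
Qed.

Lemma approx_gen_J : J `<=` approx_gen.
Proof.
move=> j Jj; split; first by case: idJ => + _ _; apply.
move=> e e0; exists 0%N => l _; exists j; split=> //; exists 0; split; first exact: above_sub0.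
by rewrite (incl0 lim) subr0 subrr nm0.
Qed.

Lemma approx_gen_munit : approx_gen (munit t).
Proof.
split; first exact: taf_munit.
move=> e e0; exists m => l ml; have [X [Xt cX uX _ _]] := sub_unitP lim t ml.
exists 0; split; first by case: (ideal_subspace idJ).
exists X; split; last by rewrite Xt subr0 subrr nm0.
split; first exact: uX.
move=> u; rewrite cX; have [tu _|_] := boolP (sub_unit t u); last by rewrite eqxx.
by exists u; rewrite ?above_refl.
Qed.

Lemma approx_gen_ideal : closed_ideal T approx_gen.
Proof.
have sJ := ideal_subspace idJ.
have cl : closed approx_gen.
  apply: closedW => x xW; split.
    apply: closed_approx (taf_closed lim) _ => e /xW[y [Ty _] xy].
    by exists y.
  move=> e e0; have [y [_ yW] xy] := xW (e / 2) ltac:(lra).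
  have [l0 l0P] := yW (e / 2) ltac:(lra); exists l0 => l /l0P[j [Jj [X [aX yX]]]].
  exists j; split=> //; exists X; split=> //.
  have -> : x - j - incl l X = (x - y) + (y - j - incl l X).
    by rewrite !addrA subrK.
  by apply: le_lt_trans (nmD _ _) _; lra.
split=> [x []//| |].
- split=> //; first by apply: approx_gen_J; case: sJ.
  move=> c x y [Tx xW] [Ty yW]; split; first by case: (taf_subspace lim) => _ _; apply.
  move=> e e0; have c0 := @nm_ge0 R C^o c.
  have d0 : 0 < e / 2 / (nm (c : C^o) + 1) by rewrite !divr_gt0 //; lra.
  have [l1 l1P] := xW _ d0; have [l2 l2P] := yW (e / 2) ltac:(lra).
  exists (maxn l1 l2) => l; rewrite geq_max => /andP[/l1P[j [Jj [X [aX xX]]]]].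
  move=> /l2P[j' [Jj' [Y [aY yY]]]].
  exists (c *: j + j'); split; first by case: sJ => _ _; apply.
  exists (c *: X + Y); split; first exact: above_subL.
  have -> : c *: x + y - (c *: j + j') - incl l (c *: X + Y) =
      c *: (x - j - incl l X) + (y - j' - incl l Y).
    by rewrite (inclL lim) !scalerBr !opprD (addrACA (c *: x)) [LHS]addrACA.
  apply: le_lt_trans (nmD _ _) _; rewrite nmZ.
  have : nm (c : C^o) * nm (x - j - incl l X) <= e / 2.
    apply: le_trans (_ : (nm (c : C^o) + 1) * (e / 2 / (nm (c : C^o) + 1)) <= _).
      by apply: ler_pM; rewrite ?nm_ge0 ?ltW //; lra.
    by rewrite mulrC divfK // lt0r_neq0 //; lra.
  by lra.
- move=> y x Ty xW.
  suff H l (Y : matAlg R (dims S l)) : upper_triangular Y ->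
      approx_gen (incl l Y ** x) /\ approx_gen (x ** incl l Y).
    split.
      apply: (@closure_lipschitz _ _ _ (fun y : A => y ** x) (nm x) _ _ _ cl _ _ Ty).
        by move=> a b; rewrite -amulBl mulrC nm_amul.
      by move=> _ [l _ [Y uY <-]]; have [] := H l Y uY.
    apply: (@closure_lipschitz _ _ _ (amul x) (nm x) _ _ _ cl _ _ Ty).
      by move=> a b; rewrite -amulBr nm_amul.
    by move=> _ [l _ [Y uY <-]]; have [] := H l Y uY.
  move=> uY; have [Tx {}xW] := xW; have TY : T (incl l Y) := taf_incl uY.
  have d0 (e : R) : 0 < e -> 0 < e / (nm (incl l Y) + 1).
    by move=> e0; rewrite divr_gt0 // ltr_pwDr ?nm_ge0.
  have dM (e a : R) : 0 < e -> 0 <= a -> a < e / (nm (incl l Y) + 1) ->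
      nm (incl l Y) * a < e.
    move=> e0 a0; rewrite ltr_pdivlMr ?ltr_pwDr ?nm_ge0 //.
    have := nm_ge0 (incl l Y); nra.
  have [_ _ JM] := idJ.
  split; (split; first exact: (taf_mul lim)) => e e0;
    have [l0 l0P] := xW _ (d0 _ e0); exists (maxn l l0) => n;
    rewrite geq_max => /andP[ln /l0P[j [Jj [X [aX xX]]]]];
    have [Y' [YY /(_ uY) uY' _]] := incl_lift lim Y ln;
    have [M1 M2] := above_subM uY' aX; have [J1 J2] := JM _ _ TY Jj.
    exists (incl l Y ** j); split=> //; exists (Y' ** X); split=> //.
    rewrite (inclM lim) YY -!amulBr; apply: le_lt_trans (nm_amul _ _) _.
    by apply: dM; rewrite ?nm_ge0.
  exists (j ** incl l Y); split=> //; exists (X ** Y'); split=> //.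
  rewrite (inclM lim) YY -!amulBl; apply: le_lt_trans (nm_amul _ _) _.
  by rewrite mulrC; apply: dM; rewrite ?nm_ge0.
Qed.

Lemma approx_gen_above (s : idx m) : approx_gen (munit s) ->
  exists l0, forall l, (l0 <= l)%N -> forall u : idx l, sub_unit s u ->
    ~ J (munit u) ->
    exists v : idx l, [/\ sub_unit t v, above v u & ~ J (munit v)].
Proof.
(* The tolerance 1 is the threshold of [ideal_munit_dist]: if [X] had no coefficient at [u], the
   corner of [j] at [u] would be within 1 of [munit u] and force it into [J]. *)
move=> [_ /(_ 1 ltr01)[l0 l0P]]; exists (maxn m l0) => l.
rewrite geq_max => /andP[ml /l0P[j [Jj [X [[uX aX] sX]]]]] u su Ju.
have uu : rproj u ** munit s ** cproj u = munit u.
  by rewrite (sub_unit_compress lim) // su scale1r.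
have X0 : coef X u != 0.
  apply/eqP => X0; apply: Ju.
  apply: (ideal_munit_dist lim idJ (y := rproj u ** j ** cproj u)).
    by apply: (ideal_mul idJ) => //; [exact: taf_rproj|exact: taf_cproj].
  apply: le_lt_trans sX.
  rewrite -{1}uu -amulBl -amulBr.
  have -> : rproj u ** (munit s - j) ** cproj u =
      rproj u ** (munit s - j - incl l X) ** cproj u.
    rewrite [in RHS]amulBr [in RHS]amulBl (compress_incl lim) X0 scale0r.
    by rewrite subr0.
  exact: nm_compress.
have [v tv vu] := aX u X0; exists v; split=> // Jv; apply: Ju.
have [_ _ JM] := idJ.
case: u vu {su uu X0} => k [i h]; rewrite -/(mk i h) => /aboveP[a [b [ve ia bh]]].
subst v; rewrite -(munitM lim i a h) -(munitM lim a b h) amulA.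
by apply: (ideal_mul idJ) => //; apply: taf_munit.
Qed.

End Generated.

Section Minimal.
Variables J K : set A.
Hypotheses (idJ : closed_ideal T J) (idK : closed_ideal T K).
Hypothesis minK : forall I, closed_ideal T I -> J `<=` I -> ~ (I `<=` J) -> K `<=` I.

Lemma minimal_ideal_above m (s t : idx m) : up_idx t ->
  K (munit s) -> K (munit t) -> ~ J (munit t) ->
  exists l0, forall l, (l0 <= l)%N -> forall u : idx l, sub_unit s u ->
    ~ J (munit u) ->
    exists v : idx l, [/\ sub_unit t v, above v u & ~ J (munit v)].
Proof.
move=> ut Ks Kt Jt; apply: (approx_gen_above idJ).
apply: minK Ks.
- exact: approx_gen_ideal.
- exact: approx_gen_J.
- by move=> H; apply/Jt/H/approx_gen_munit.
Qed.

(* Below any sub-unit of [s] outside [J] lies a sub-unit of [t] outside [J], and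
   vice versa; as a level is finite, this descent must become stationary. *)
Lemma minimal_ideal_munit_uniq m (s t : idx m) : up_idx s -> up_idx t ->
  K (munit s) -> K (munit t) -> ~ J (munit s) -> ~ J (munit t) -> s = t.
Proof.
move=> us ut Ks Kt Js Jt.
have [l1 P1] := minimal_ideal_above ut Ks Kt Jt.
have [l2 P2] := minimal_ideal_above us Kt Ks Js.
pose l := maxn m (maxn l1 l2); have ml : (m <= l)%N := leq_maxl _ _.
have {}P1 := P1 l ltac:(by rewrite /l !leq_max leqnn orbT).
have {}P2 := P2 l ltac:(by rewrite /l !leq_max leqnn !orbT).
(* The distance to the diagonal, a true difference on upper triangular units. It drops strictly
   unless [v = u], in which case [s] and [t] share a sub-unit. The two units swap roles at each
   step, hence the quantification over [s'] and [t']. *)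
pose w (u : idx l) := ((tagged u).2 - (tagged u).1)%N.
pose down (s' t' : idx m) := forall u : idx l, sub_unit s' u -> ~ J (munit u) ->
  exists v : idx l, [/\ sub_unit t' v, above v u & ~ J (munit v)].
have H n s' t' : up_idx s' -> up_idx t' -> down s' t' -> down t' s' ->
    forall u : idx l, sub_unit s' u -> ~ J (munit u) -> (w u < n)%N -> s' = t'.
  elim: n s' t' => [//|n IH] s' t' us' ut' D D' u su Ju; rewrite ltnS => wn.
  have [v [tv vu Jv]] := D u su Ju.
  have [uv|uv] := eqVneq u v; first by subst v; apply: (sub_unit_inj ml su tv).
  apply/esym/(IH t' s' ut' us' D' D v) => //; apply: leq_trans wn.
  have uu := sub_unit_up lim ml us' su; have uv' := sub_unit_up lim ml ut' tv.
  case: u uu vu uv {su Ju} => k [i h]; rewrite -/(mk i h) => uu.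
  move=> /aboveP[a [b [ve ia bh]]]; subst v; move: uu uv'.
  rewrite /up_idx /w mk_inj /= => ih ab; rewrite negb_and.
  by rewrite -!val_eqE /= => neq; lia.
have [u su Ju] : exists2 u : idx l, sub_unit s u & ~ J (munit u).
  apply: contrapT => no; apply: Js; rewrite (munit_sub_sum lim s ml).
  apply: subspace_sum (ideal_subspace idJ) _ => u su.
  by apply: contrapT => Ju; apply: no; exists u.
exact: (H (w u).+1 s t us ut P1 P2 u su Ju).
Qed.

(** At each level from [m] on, a single sub-unit [f] of [e] lies outside [J], so [e] and [f] agree
    modulo [J]. A product of [f] with a matrix unit is 0 or a unit in [K], and such a unit lies in
    [J] or equals [f] by uniqueness. *)
Lemma minimal_ideal_munit : ~ (K `<=` J) ->
  exists m (e : idx m), [/\ up_idx e, K (munit e), ~ J (munit e)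
    & forall l (y : idx l), (m <= l)%N -> up_idx y ->
      (J (munit y ** munit e) \/ J (munit y ** munit e - munit e)) /\
      (J (munit e ** munit y) \/ J (munit e ** munit y - munit e))].
Proof.
move=> KJ; have sJ := ideal_subspace idJ; have [_ _ JM] := idJ.
have [_ _ KM] := idK.
have [m [e [ue Ke Je]]] : exists m (e : idx m),
    [/\ up_idx e, K (munit e) & ~ J (munit e)].
  apply: contrapT => no; apply/KJ/(ideal_inductive lim idK idJ) => l t ut Kt.
  by apply: contrapT => Jt; apply: no; exists l, t.
exists m, e; split=> // l y ml uy.
have [f [ef uf Kf Jf]] : exists f : idx l,
    [/\ J (munit e - munit f), up_idx f, K (munit f) & ~ J (munit f)].
  have Kf (f : idx l) : sub_unit e f -> K (munit f).
    move=> ef; rewrite -(munitMsub lim ml ef).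
    by have [] := KM _ _ (@taf_cproj _ _ _ incl _ f) Ke.
  have [f ef Jf] : exists2 f : idx l, sub_unit e f & ~ J (munit f).
    apply: contrapT => no; apply: Je; rewrite (munit_sub_sum lim e ml).
    apply: subspace_sum sJ _ => u su.
    by apply: contrapT => Ju; apply: no; exists u.
  have uf := sub_unit_up lim ml ue ef.
  exists f; split=> //; last exact: Kf.
  rewrite (munit_sub_sum lim e ml) (bigD1 f) //= addrAC subrr add0r.
  apply: subspace_sum sJ _ => u /andP[eu uneq].
  apply: contrapT => Ju; case/eqP: uneq.
  apply: minimal_ideal_munit_uniq => //; last exact: Kf.
    exact: (sub_unit_up lim ml ue eu).
  exact: Kf.
have Ty : T (munit y) := taf_munit uy.
have [ye ey] := JM _ _ Ty ef; rewrite amulBr in ye; rewrite amulBl in ey.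
have key z : K z -> (z = 0 \/ exists2 v : idx l, up_idx v & z = munit v) ->
    z = 0 \/ J z \/ z = munit f.
  move=> Kz [->|[v uv zv]]; first by left.
  right; have [Jz|Jz] := pselect (J z); first by left.
  by right; rewrite zv (@minimal_ideal_munit_uniq _ v f) // -zv.
have concl z : J (z - munit f) \/ J z ->
    forall x, J (x - z) -> J x \/ J (x - munit e).
  move=> [Jz|Jz] x Jx; [right|left].
    have -> : x - munit e = (x - z) + (z - munit f) - (munit e - munit f).
      by rewrite opprB addrA (addrA (x - z)) !subrK.
    by apply: (subspaceB sJ) => //; apply: (subspaceD sJ).
  by rewrite -(subrK z x); apply: (subspaceD sJ).
have J0 : J 0 by case: sJ.
have [K1 K2] := KM _ _ Ty Kf.
have mulP (s t : idx l) : up_idx s -> up_idx t ->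
    munit s ** munit t = 0 \/ exists2 v : idx l, up_idx v & munit s ** munit t = munit v.
  have [|ne] := eqVneq (col_idx s) (row_idx t); last by left; apply: munitM0.
  case: s => k [i j]; case: t => q [a b]; rewrite /col_idx /row_idx /= => e1.
  have kq : k = q by case: e1.
  subst q; move/eqP: e1; rewrite mk_inj => /andP[/eqP ja _]; subst a.
  rewrite /up_idx /= => ij jb; right; exists (mk i b); last exact: (munitM lim).
  exact: leq_trans jb.
split.
  apply: concl ye; have [->|[Jz|->]] := key _ K1 (mulP _ _ uy uf);
    by [right|right|left; rewrite subrr].
apply: concl ey; have [->|[Jz|->]] := key _ K2 (mulP _ _ uf uy);
  by [right|right|left; rewrite subrr].
Qed.

End Minimal.
End MinimalIdeal.

Lemma nm_div (R : realType) (a b : R[i]) :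
  nm (a / b : R[i]^o) = nm (a : R[i]^o) / nm (b : R[i]^o).
Proof.
by apply: (@complexI R); rewrite rmorphM fmorphV /= -!normE normf_div.
Qed.

Lemma cauchy_seq_lim (R : realType) (V : completeNormedModType R[i])
    (u : nat -> V) :
  (forall e : R, 0 < e ->
     exists N, forall n, (N <= n)%N -> nm (u N - u n) < e) ->
  exists l, forall e : R, 0 < e ->
    exists N, forall n, (N <= n)%N -> nm (l - u n) < e.
Proof.
move=> uC; have : cauchy (u @ \oo).
  apply: cauchy_exP => e e0.
  have re0 : 0 < complex.Re e by move: e0; rewrite ltcE => /andP[].
  have [N NP] := uC _ re0; exists (u N); exists N => // n /= Nn.
  rewrite -ball_normE /= normE ltcE /= NP // andbT.
  by move: e0; rewrite ltcE => /andP[].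
move=> /cauchy_cvgP/cvg_ex[/= l /cvgrPdist_lt ul]; exists l => e e0.
have [|N _ NP] := ul (e%:C)%C; first by rewrite ltcR.
by exists N => n /NP; rewrite normE ltcR.
Qed.

(** * Hilbert spaces *)

Section HilbertSpace.
Variables (R : realType) (H : hilbertType R).
Local Notation C := R[i].
Implicit Types (x y v w : H) (M : set H).

Lemma nm_inner x : inner x x = ((nm x ^+ 2)%:C)%C.
Proof. by rewrite -norm_inner normE rmorphXn. Qed.

Lemma nm_innerE x : nm (inner x x : C^o) = nm x ^+ 2.
Proof.
apply: (@complexI R); rewrite -normE -nm_inner ger0_norm //.
Qed.

Lemma inner_eq0 x : inner x x = 0 -> x = 0.
Proof. by move=> /eqP; rewrite dnorm_eq0 => /eqP. Qed.

Lemma inner_conj x y : inner x y = (inner y x)^*.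
Proof. by rewrite hermC expr0 mul1r. Qed.

Lemma inner_eq0C x y : inner x y = 0 -> inner y x = 0.
Proof. by move=> xy; rewrite inner_conj xy conjC0. Qed.

Lemma nm_pythagoras x y : inner x y = 0 ->
  nm (x + y) ^+ 2 = nm x ^+ 2 + nm y ^+ 2.
Proof.
move=> xy; apply: (@complexI R); rewrite rmorphD /= -!nm_inner dnormD xy.
by rewrite conjC0 !addr0.
Qed.

Lemma inner_sub_proj x y : y != 0 ->
  inner (x - (inner x y / inner y y) *: y) y = 0.
Proof.
move=> y0; rewrite linearBl linearZl_LR /= divfK ?subrr //.
by rewrite dnorm_eq0.
Qed.

Lemma nm_sub_proj x y : y != 0 ->
  nm (x - (inner x y / inner y y) *: y) ^+ 2
  = nm x ^+ 2 - (nm (inner x y : C^o) / nm y) ^+ 2.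
Proof.
move=> y0; set c := inner x y / inner y y; set z := x - c *: y.
have zy : inner z (c *: y) = 0.
  by rewrite linearZr_LR /= inner_sub_proj // mulr0.
have := nm_pythagoras zy; rewrite subrK => ->.
suff -> : nm (c *: y) = nm (inner x y : C^o) / nm y by rewrite addrK.
have ny0 : nm y != 0 by apply: contra_neq y0 => /nm_eq0.
by rewrite nmZ nm_div nm_innerE expr2 invfM mulrA divfK.
Qed.

Lemma cauchy_schwarz x y : nm (inner x y : C^o) <= nm x * nm y.
Proof.
have [->|y0] := eqVneq y 0.
  by rewrite linear0r /= nm0 mulr_ge0 ?nm_ge0.
have ny0 : 0 < nm y.
  by rewrite lt_neqAle nm_ge0 andbT eq_sym; apply: contra_neq y0 => /nm_eq0.
rewrite -ler_pdivrMr // -(@ler_pXn2r _ 2) ?nnegrE ?nm_ge0 ?divr_ge0 ?nm_ge0 //.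
by rewrite -subr_ge0 -nm_sub_proj // sqr_ge0.
Qed.

Lemma nm_parallelogram x y :
  nm (x - y) ^+ 2 + nm (x + y) ^+ 2 = 2 * nm x ^+ 2 + 2 * nm y ^+ 2.
Proof.
apply: (@complexI R); rewrite !mulr2n !mulrDl !mul1r !rmorphD /= -!nm_inner.
by rewrite dnormB dnormD addrACA addNr addr0 [RHS]addrACA.
Qed.

Lemma inner_near_neq0 v y : nm (v - y) < nm v -> inner y v != 0.
Proof.
move=> yv; apply/eqP => /inner_eq0C y0.
have /nm_pythagoras : inner v (- y) = 0 by rewrite linearNr /= y0 oppr0.
rewrite nmN => e.
have : nm (v - y) ^+ 2 < nm v ^+ 2 by rewrite ltr_pXn2r ?nnegrE ?nm_ge0.
by rewrite e ltNge lerDl sqr_ge0.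
Qed.

Lemma closed_span_sub (E : set H) : closed_subspace (closed_span E).
Proof.
split=> [|M [[] //]|c x y Ex Ey M ME]; last first.
  by case: (ME) => -[_ _ ML] _; apply: ML; [apply: Ex|apply: Ey].
apply: closedW => x xE M ME; case: (ME) => -[cM _ _] _.
by apply: closed_approx cM _ => e /xE[y yE]; exists y => //; apply: yE.
Qed.

Lemma closed_span_line (g : H) : closed_span [set g] = [set c *: g | c in @setT C].
Proof.
apply/seteqP; split => [x|_ [c _ <-] M [sM /(_ g erefl) Mg]]; last exact: subspaceZ.
apply; split; last by move=> _ ->; exists 1; rewrite ?scale1r.
split; last 2 first.
- by exists 0; rewrite ?scale0r.
- move=> c _ _ [a _ <-] [b _ <-]; exists (c * a + b) => //.
  by rewrite scalerDl scalerA.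
apply: closedW => {}x xl; have [g0|g0] := eqVneq g 0.
  exists 0 => //; rewrite scale0r; apply/esym/nm_eq0/eqP.
  rewrite eq_le nm_ge0 andbT leNgt; apply/negP => /xl[_ [c _ <-]].
  by rewrite g0 scaler0 subr0 ltxx.
exists (inner x g / inner g g) => //; apply/esym/subr0_eq/nm_eq0/eqP.
rewrite eq_le nm_ge0 andbT leNgt; apply/negP => /xl[_ [c _ <-]].
apply/negP; rewrite -leNgt -(@ler_pXn2r _ 2) ?nnegrE ?nm_ge0 //.
set p := inner x g / inner g g; set z := x - p *: g.
have -> : x - c *: g = z + (p - c) *: g.
  by rewrite scalerBl addrA subrK.
have zg : inner z ((p - c) *: g) = 0.
  by rewrite linearZr_LR /= inner_sub_proj // mulr0.
by rewrite (nm_pythagoras zg) lerDl sqr_ge0.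
Qed.

(** The left side is [4 * d * (a + b) + 2 * a ^+ 2 + 2 * b ^+ 2], at most [(8 * d + 4) * f]; the
    constant 5 makes the bound strict. It serves the Cauchy estimate for a minimizing sequence. *)
Let sq_bound (a b f d : R) : a < f -> b < f -> 0 < a -> 0 < b -> 0 < f ->
  f <= 1 -> 0 <= d ->
  2 * (d + a) ^+ 2 + 2 * (d + b) ^+ 2 - 4 * d ^+ 2 < (8 * d + 5) * f.
Proof.
move=> af bf a0 b0 f0 f1 d0.
have da : d * a <= d * f by rewrite ler_wpM2l // ltW.
have db : d * b <= d * f by rewrite ler_wpM2l // ltW.
have aa : a ^+ 2 <= f by rewrite expr2; nra.
have bb : b ^+ 2 <= f by rewrite expr2; nra.
rewrite !sqrrD; lra.
Qed.

(** [h] is [v] minus its nearest point in [M]. Midpoints of a minimizing sequence stay in [M], so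
    the parallelogram law makes the sequence Cauchy. *)
Lemma exists_orthogonal M v : closed_subspace M -> ~ M v ->
  exists2 h, h != 0 & forall m, M m -> inner h m = 0.
Proof.
move=> [cM M0 ML] Mv; pose D := [set nm (v - m) | m in M].
have D0 : D !=set0 by exists (nm (v - 0)), 0.
have lbD : has_lbound D by exists 0 => _ [m _ <-]; apply: nm_ge0.
have infD : has_inf D by [].
pose d := inf D; have dle m : M m -> d <= nm (v - m).
  by move=> Mm; apply: ge_inf => //; exists m.
have d0 : 0 <= d by apply: lb_le_inf => // _ [m _ <-]; apply: nm_ge0.
have near (e : R) : 0 < e -> exists2 m, M m & nm (v - m) < d + e.
  by move=> e0; have [_ [m Mm <-] md] := inf_adherent e0 infD; exists m.
have e_ n : 0 < (n.+1%:R : R)^-1 by rewrite invr_gt0 ltr0n.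
pose u n : H := projT1 (cid2 (near _ (e_ n))).
have Mu n : M (u n) by rewrite /u; case: cid2.
have ud n : nm (v - u n) < d + n.+1%:R^-1 by rewrite /u; case: cid2.
have uu n k : nm (u n - u k) ^+ 2 <=
    2 * (d + n.+1%:R^-1) ^+ 2 + 2 * (d + k.+1%:R^-1) ^+ 2 - 4 * d ^+ 2.
  have := nm_parallelogram (v - u k) (v - u n).
  have -> : v - u k - (v - u n) = u n - u k.
    by rewrite opprB addrC addrA subrK.
  have -> : v - u k + (v - u n) = (2 : C) *: (v - ((2 : C)^-1 *: (u k + u n))).
    rewrite scalerBr scalerA mulfV ?pnatr_eq0 // scale1r scaler_nat mulr2n.
    by rewrite opprD addrACA.
  rewrite nmZ (_ : nm (2 : C^o) = 2); last first.
    by apply: (@complexI R); rewrite -normE rmorph_nat normr_nat.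
  have Mm : M ((2 : C)^-1 *: (u k + u n)).
    by apply: (subspaceZ _ (And3 cM M0 ML)); apply: subspaceD.
  have dp := dle _ Mm; set p := nm (v - _ *: _) in dp *.
  have sq a k' : 0 <= a -> a < d + k'.+1%:R^-1 -> a ^+ 2 <= (d + k'.+1%:R^-1) ^+ 2.
    have ek := ltW (e_ k'); move=> a0 /ltW ak.
    by apply: lerXn2r; rewrite ?nnegrE ?addr_ge0.
  have := sq _ _ (nm_ge0 _) (ud n); have := sq _ _ (nm_ge0 _) (ud k).
  have dp2 : d ^+ 2 <= p ^+ 2 by rewrite lerXn2r ?nnegrE ?nm_ge0.
  move: ((d + k.+1%:R^-1) ^+ 2) ((d + n.+1%:R^-1) ^+ 2) => a b ka nb.
  by rewrite exprMn; lra.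
have archi (e : R) : 0 < e -> exists N, forall n, (N <= n)%N -> n.+1%:R^-1 < e.
  move=> e0; exists (Num.bound e^-1) => n Nn.
  rewrite -[e]invrK ltf_pV2 ?posrE ?invr_gt0 ?ltr0n //.
  apply: lt_le_trans (archi_boundP _) _; first by rewrite invr_ge0 ltW.
  by rewrite ler_nat; apply: leqW.
have [l lP] : exists l, forall e : R, 0 < e ->
    exists N, forall n, (N <= n)%N -> nm (l - u n) < e.
  apply: cauchy_seq_lim => e e0.
  pose f := Num.min 1 (e ^+ 2 / (8 * d + 5)).
  have f0 : 0 < f by rewrite lt_min ltr01 divr_gt0 ?exprn_gt0 //; lra.
  have [N NP] := archi f f0; exists N => n Nn.
  rewrite -(@ltr_pXn2r _ 2) ?nnegrE ?nm_ge0 // ?ltW //.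
  apply: le_lt_trans (uu N n) _.
  apply: (@lt_le_trans _ _ ((8 * d + 5) * f)).
    have f1 : f <= 1 by rewrite ge_min lexx.
    exact: sq_bound (NP N (leqnn N)) (NP n Nn) (e_ N) (e_ n) f0 f1 d0.
  by rewrite mulrC -ler_pdivlMr ?ge_min ?lexx ?orbT //; lra.
have Ml : M l.
  apply: closed_approx => // e /lP[N NP]; exists (u N) => //.
  exact: NP.
exists (v - l); first by apply: contra_notN Mv; rewrite subr_eq0 => /eqP->.
have vl : nm (v - l) <= d.
  rewrite leNgt; apply/negP => dl.
  pose e := (nm (v - l) - d) / 2; have e0 : 0 < e by rewrite /e; lra.
  have [N1 P1] := archi e e0; have [N2 P2] := lP e e0.
  have := P1 _ (leq_maxl N1 N2); have := P2 _ (leq_maxr N1 N2).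
  have := ud (maxn N1 N2); set n := maxn N1 N2.
  have : nm (v - l) <= nm (v - u n) + nm (l - u n).
    rewrite (nmBC l); apply: le_trans (nmD _ _).
    by rewrite addrA subrK.
  by rewrite /e; move: (n.+1%:R^-1) => q; lra.
move=> m Mm; have [->|m0] := eqVneq m 0; first exact: linear0r.
(* Removing the component along [m] would shorten [v - l] below the minimal distance [d], unless
   that component is 0. *)
have := nm_sub_proj (v - l) m0.
set c := _ / _; have : d <= nm (v - l - c *: m).
  rewrite -addrA -opprD; apply/dle.
  by rewrite addrC; apply: ML.
move=> dc e; apply/(@nm_eq0 R C^o)/eqP.
have : (nm (inner (v - l) m : C^o) / nm m) ^+ 2 <= 0.
  have : nm (v - l) ^+ 2 <= nm (v - l - c *: m) ^+ 2.
    by rewrite lerXn2r ?nnegrE ?nm_ge0 // (le_trans vl).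
  by rewrite e; lra.
rewrite le_eqVlt ltNge sqr_ge0 orbF sqrf_eq0 mulf_eq0 invr_eq0.
by case/orP=> // /eqP/nm_eq0 mm; rewrite mm eqxx in m0.
Qed.

End HilbertSpace.

Lemma closed_subspace0 (R : realType) (V : completeNormedModType R[i]) :
  closed_subspace [set (0 : V)].
Proof.
split=> // [|c x y -> ->]; last by rewrite scaler0 addr0.
apply: closedW => x x0; apply/nm_eq0/eqP; rewrite eq_le nm_ge0 andbT leNgt.
by apply/negP => /x0[_ -> /=]; rewrite subr0 ltxx.
Qed.

Lemma closed_subspace_forall (R : realType) (V : completeNormedModType R[i])
    (I : Type) (F : I -> set V) :
  (forall i, closed_subspace (F i)) -> closed_subspace [set x | forall i, F i x].
Proof.
move=> FF; split=> [|i|c x y Fx Fy i]; last 2 first.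
- by case: (FF i).
- by case: (FF i) => _ _; apply.
apply: closedW => x xF i; have [cF _ _] := FF i.
by apply: closed_approx cF _ => e /xF[y yF]; exists y.
Qed.

Lemma closed_subspaceI (R : realType) (V : completeNormedModType R[i])
    (E F : set V) :
  closed_subspace E -> closed_subspace F -> closed_subspace [set x | E x /\ F x].
Proof.
move=> [cE E0 EL] [cF F0 FL]; split=> [||c x y [Ex Fx] [Ey Fy]] //; last first.
  by split; [apply: EL|apply: FL].
apply: closedW => x xEF.
by split; apply: closed_approx => // e /xEF[y [Ey Fy]]; exists y.
Qed.

(** * Nest representations *)

Section Representation.
Variables (R : realType) (A : cstarAlgType R) (T : set A) (H : hilbertType R).
Variable rho : A -> H -> H.
Local Notation C := R[i].
Hypotheses (sT : closed_subspace T)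
  (mT : forall x y, T x -> T y -> T (x ** y))
  (rep : representation T rho).

Lemma rep_nm_bound : exists2 c : R, 0 <= c &
  forall x v, T x -> nm (rho x v) <= c * nm x * nm v.
Proof.
have [c cP] := rep_bounded rep; exists (nm (c : C^o)); first exact: nm_ge0.
move=> x v Tx; have cxv := cP x v Tx.
(* The constant [c] is complex, but the whole bound is nonnegative and thus equals its own norm, so
   [c] may be replaced by its modulus. *)
have z0 := le_trans (normr_ge0 _) cxv.
rewrite -lecR !rmorphM /= -!normE; apply: le_trans cxv _.
by rewrite -(ger0_norm z0) !normrM !normr_id.
Qed.

Lemma rep_vlinear x (c : C) v w : T x ->
  rho x (c *: v + w) = c *: rho x v + rho x w.
Proof. by move=> Tx; have [L _] := rep_operator rep Tx; apply: L. Qed.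

Lemma rep_v0 x : T x -> rho x 0 = 0.
Proof.
move=> Tx; have := rep_vlinear 1 0 0 Tx; rewrite !scale1r addr0.
by move/eqP; rewrite -subr_eq subrr eq_sym => /eqP.
Qed.

Lemma rep_vZ x (c : C) v : T x -> rho x (c *: v) = c *: rho x v.
Proof. by move=> Tx; rewrite -(addr0 (c *: v)) rep_vlinear // rep_v0 // addr0. Qed.

Lemma rep_vB x v w : T x -> rho x (v - w) = rho x v - rho x w.
Proof. by move=> Tx; rewrite addrC -scaleN1r rep_vlinear // scaleN1r addrC. Qed.

Lemma rep_0 v : rho 0 v = 0.
Proof.
have T0 : T 0 by case: sT.
have := rep_linear rep 1 v T0 T0; rewrite !scale1r addr0.
by move/eqP; rewrite -subr_eq subrr eq_sym => /eqP.
Qed.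

Lemma rep_Z (c : C) x v : T x -> rho (c *: x) v = c *: rho x v.
Proof.
move=> Tx; have T0 : T 0 by case: sT.
by rewrite -(addr0 (c *: x)) (rep_linear rep) // rep_0 addr0.
Qed.

Lemma rep_B x y v : T x -> T y -> rho (x - y) v = rho x v - rho y v.
Proof.
by move=> Tx Ty; rewrite addrC -scaleN1r (rep_linear rep) // scaleN1r addrC.
Qed.

Lemma rep_sum (I : Type) (r : seq I) (P : pred I) (F : I -> A) v :
  (forall i, P i -> T (F i)) ->
  rho (\sum_(i <- r | P i) F i) v = \sum_(i <- r | P i) rho (F i) v.
Proof.
move=> TF; elim: r => [|i r IH]; first by rewrite !big_nil rep_0.
rewrite !big_cons; case: ifP => // Pi.
rewrite -(scale1r (F i)) (rep_linear rep) ?scale1r ?IH //; first exact: TF.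
exact: subspace_sum.
Qed.

Lemma rep_elt_preimage (L : set H) w : closed_subspace L ->
  closed_subspace [set x | T x /\ L (rho x w)].
Proof.
move=> [cL L0 LL]; have [cT T0 TL] := sT; split; last 2 first.
- by split; rewrite ?rep_0.
- move=> c x y [Tx Lx] [Ty Ly]; split; first exact: TL.
  by rewrite (rep_linear rep) //; apply: LL.
apply: closedW => x xP.
have Tx : T x by apply: closed_approx cT _ => e /xP[y [Ty _]]; exists y.
split=> //; apply: closed_approx cL _ => e e0.
have [c c0 cP] := rep_nm_bound.
have cw : 0 < c * nm w + 1 by rewrite ltr_pwDr // mulr_ge0 ?nm_ge0.
have [y [Ty Ly] xy] := xP (e / (c * nm w + 1)) ltac:(by rewrite divr_gt0).
exists (rho y w) => //; rewrite -rep_B //.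
have Txy : T (x - y) by apply: subspaceB.
apply: le_lt_trans (cP _ _ Txy) _; rewrite ltr_pdivlMr // in xy.
apply: le_lt_trans xy; rewrite mulrAC mulrC ler_wpM2l ?nm_ge0 //; lra.
Qed.

Lemma rep_vec_preimage (L : set H) x : closed_subspace L -> T x ->
  closed_subspace [set v | L (rho x v)].
Proof.
move=> [cL L0 LL] Tx; split; last 2 first.
- by rewrite /= rep_v0.
- by move=> c v w Lv Lw; rewrite /= rep_vlinear //; apply: LL.
apply: closedW => v vP; apply: closed_approx cL _ => e e0.
have [c c0 cP] := rep_nm_bound.
have cx : 0 < c * nm x + 1 by rewrite ltr_pwDr // mulr_ge0 ?nm_ge0.
have [w Lw vw] := vP (e / (c * nm x + 1)) ltac:(by rewrite divr_gt0).
exists (rho x w) => //; rewrite -rep_vB //.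
apply: le_lt_trans (cP _ _ Tx) _; rewrite ltr_pdivlMr // in vw.
apply: le_lt_trans vw; rewrite mulrC ler_wpM2l ?nm_ge0 //; lra.
Qed.

Lemma rep_ker_ideal : closed_ideal T (rep_ker T rho).
Proof.
split=> [x []//| |x y Tx [Ty y0]]; last first.
  split; (split; [exact: mT|move=> v]); rewrite (rep_mul rep) //.
  by rewrite y0 rep_v0.
have -> : rep_ker T rho =
    [set x | T x /\ forall v, [set y | T y /\ [set (0 : H)] (rho y v)] x].
  apply/seteqP; split=> x [Tx x0]; split=> // v; first by split=> //; apply: x0.
  by have [_] := x0 v.
apply: closed_subspaceI => //; apply: closed_subspace_forall => v.
exact/rep_elt_preimage/closed_subspace0.
Qed.

(** Multiples of [w] are included because [T] need not have a unit, so [w] need not be a limit of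
    vectors [rho x w]. *)
Lemma cyclic_Lat (w : H) :
  Lat T rho (closure [set v | exists c x, T x /\ v = c *: w + rho x w]).
Proof.
set E := [set _ | _]; have [_ T0 TL] := sT.
have cE : closed_subspace (closure E).
  apply: closed_subspaceP.
    by exists 0, 0; rewrite rep_0 scale0r addr0.
  move=> c _ _ [a [x [Tx ->]]] [b [y [Ty ->]]]; exists (c * a + b), (c *: x + y).
  split; first exact: TL.
  by rewrite (rep_linear rep) // scalerDl !scalerDr scalerA addrACA.
split=> // z v Tz; have [c _ cP] := rep_nm_bound.
apply: (@closure_lipschitz _ _ _ (rho z) (c * nm z) E (closure E)).
- by move=> x y; rewrite -rep_vB // cP.
- by case: cE.
- move=> _ [a [x [Tx ->]]]; apply: subset_closure; exists 0, (a *: z + z ** x).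
  split; first by apply: TL => //; apply: mT.
  by rewrite scale0r add0r (rep_linear rep) ?(rep_mul rep) ?rep_vlinear //; apply: mT.
Qed.

End Representation.

(** * The extreme elements of a nest *)

Section NestExtremes.
Variables (R : realType) (H : hilbertType R) (N : set (set H)).
Hypothesis chain : forall L M, N L -> N M -> L `<=` M \/ M `<=` L.

Lemma zero_plusP (g : H) : g != 0 -> zero_plus N = closed_span [set g] ->
  N (closed_span [set g]) /\ forall M, N M -> M <> [set 0] -> M g.
Proof.
move=> g0 Ng; have gg : closed_span [set g] g by move=> M [_]; apply.
have [[L PL]|no] := pselect (exists L, [set M | [/\ N M, M <> [set 0] &
    forall M', N M' -> M' <> [set 0] -> M' `<=` M -> M' = M]] L); last first.
  (* Without a minimal element [zero_plus] would be its default [[set 0]], which misses [g]. Below,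
     the chain condition makes a minimal element least. *)
  have : [set (0 : H)] g.
    rewrite -(@xgetPN _ [set 0] [set M | [/\ N M, M <> [set 0] &
      forall M', N M' -> M' <> [set 0] -> M' `<=` M -> M' = M]]).
      by move: gg; rewrite -Ng.
    by move=> M PM; apply: no; exists M.
  by move=> /= g00; rewrite g00 eqxx in g0.
have := xgetI [set 0] PL; rewrite -/(zero_plus N) Ng => -[NL L0 minL].
split=> // M NM M0; have [|/(_ _ gg)//] := chain NM NL.
by move=> /minL ->.
Qed.

Lemma zero_plusE (L : set H) : N L -> L <> [set 0] ->
  (forall M, N M -> M <> [set 0] -> L `<=` M) -> zero_plus N = L.
Proof.
move=> NL L0 minL; apply: xget_unique.
  by split=> // M NM M0 ML; apply/seteqP; split=> //; apply: minL.
by move=> M [NM M0 MM]; rewrite (MM L) //; apply: minL.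
Qed.

Lemma one_minusP (h : H) : h != 0 ->
  orthocomplement (one_minus N) = closed_span [set h] ->
  [/\ N (one_minus N), ~ one_minus N h &
    forall M, N M -> M <> setT -> M `<=` one_minus N].
Proof.
move=> h0 Nh; have hh : orthocomplement (one_minus N) h.
  by rewrite Nh => M [_]; apply.
have nh : ~ one_minus N h.
  by move=> /hh/inner_eq0/eqP; rewrite (negbTE h0).
have [[L PL]|no] := pselect (exists L, [set M | [/\ N M, M <> setT &
    forall M', N M' -> M' <> setT -> M' `<=` M]] L); last first.
  case: nh; rewrite /one_minus xgetPN //.
  by move=> M PM; apply: no; exists M.
by have := xgetI setT PL; rewrite -/(one_minus N) => -[].
Qed.

Lemma one_minusE (L : set H) : N L -> L <> setT ->
  (forall M, N M -> M <> setT -> M `<=` L) -> one_minus N = L.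
Proof.
move=> NL LT maxL; apply: xget_unique; first by split.
move=> M [NM MT MM]; apply/seteqP; split; [exact: maxL|exact: MM].
Qed.

End NestExtremes.

(** * From complete meet irreducibility to a rank one operator *)

Section NestRepresentation.
Variables (R : realType) (S : tafSystem R) (A : cstarAlgType R).
Variable incl : forall i, matAlg R (dims S i) -> A.
Arguments incl : clear implicits.
Hypothesis lim : is_cstar_limit incl.
Variables (H : hilbertType R) (rho : A -> H -> H).
Local Notation C := R[i].
Local Notation idx l := (mat_index (dims S l)).
Local Notation T := (taf_algebra incl).
Local Notation munit := (@munit R S A incl _).
Local Notation rproj := (@rproj R S A incl _).
Local Notation cproj := (@cproj R S A incl _).
Hypothesis rep : representation T rho.
Hypothesis nest : forall M N, Lat T rho M -> Lat T rho N -> M `<=` N \/ N `<=` M.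

Let sT : closed_subspace T := taf_subspace lim.
Let mT : forall x y, T x -> T y -> T (x ** y) := taf_mul lim.
Local Notation J := (rep_ker T rho).

(** Elements of low levels reappear at higher ones, so finitely many levels may be skipped; the
    products with the minimal unit [e] are controlled from the level of [e] on. *)
Lemma taf_sub (P : set A) m : closed_subspace P ->
  (forall l (u : idx l), (m <= l)%N -> up_idx u -> P (munit u)) -> T `<=` P.
Proof.
move=> sP PU x Tx; have [cP P0 _] := sP; apply: closed_approx cP _ => e e0.
have [n nP] := taf_approx lim Tx e0.
have [X /upper_coef uX xX] := nP _ (leq_maxr m n); exists (incl (maxn m n) X) => //.
rewrite (mat_unit_sum X) (incl_sum lim); apply: subspace_sum (sP) _ => u _.
rewrite (inclZ lim) -munitE; have [uu|/uX->] := boolP (up_idx u).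
  by apply: subspaceZ (sP) _; apply: PU => //; apply: leq_maxl.
by rewrite scale0r.
Qed.

(** The successor is the intersection of all closed ideals strictly above the kernel; were it the
    kernel, complete meet irreducibility would place the kernel among those ideals. *)
Lemma cmi_successor : completely_meet_irreducible T J ->
  exists K, [/\ closed_ideal T K, J `<=` K, ~ (K `<=` J) &
    forall I, closed_ideal T I -> J `<=` I -> ~ (I `<=` J) -> K `<=` I].
Proof.
move=> [[JT sJ JM] cmi].
pose F := [set K | [/\ closed_ideal T K, J `<=` K & ~ (K `<=` J)]].
exists (T `&` \bigcap_(K in F) K); split.
- split=> [x []//| |x y Tx [Ty Fy]].
    have -> : T `&` \bigcap_(K in F) K =
        [set x | T x /\ forall KF : {K | F K}, [set x | sval KF x] x].
      apply/seteqP; split=> x [Tx Fx]; split=> //; first by move=> [K FK]; apply: Fx.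
      by move=> K FK; apply: (Fx (exist _ K FK)).
    apply: closed_subspaceI => //; apply: closed_subspace_forall => -[K FK] /=.
    by have [idK _ _] := FK; exact: ideal_subspace idK.
  have FM K : F K -> K (x ** y) /\ K (y ** x).
    by move=> FK; have [[_ _ KM] _ _] := FK; apply: KM => //; apply: Fy.
  by split; (split; first exact: mT) => K FK; have [] := FM K FK.
- by move=> x Jx; split; [exact: JT|move=> K [_ JK _]; apply: JK].
- move=> FJ; have [_ _] : F J; last by apply.
  apply: cmi => [K [idK JK _]//|]; apply/seteqP; split=> // x Jx.
  by split; [exact: JT|move=> K [_ JK _]; apply: JK].
- by move=> I idI JI IJ x [_]; apply.
Qed.

(* Modulo the kernel every matrix unit either annihilates or fixes the minimal
   unit [e], on either side; hence the range and the kernel of [rho e] are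
   invariant, and comparability of the lines in the range makes it a line. *)
Lemma cmi_rank_one : completely_meet_irreducible T J ->
  exists g h : H, [/\ g != 0, h != 0,
    zero_plus (Lat T rho) = closed_span [set g],
    orthocomplement (one_minus (Lat T rho)) = closed_span [set h]
  & exists2 x, T x & rho x = rank_one g h].
Proof.
move=> /cmi_successor[K [idK JK KJ minK]].
have idJ : closed_ideal T J := rep_ker_ideal sT mT rep.
have [m [e [ue Ke Je He]]] := minimal_ideal_munit lim idJ idK minK KJ.
have Te : T (munit e) := taf_munit ue.
pose R0 := rho (munit e).
have span_sub (w : H) : closed_subspace (closed_span [set w]).
  exact: closed_span_sub.
have JR z v : T z -> J z \/ J (z - munit e) -> rho z v = 0 \/ rho z v = R0 v.
  move=> Tz [[_ ->]|[_ /(_ v)]]; first by left.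
  by rewrite (rep_B rep) // => /subr0_eq; right.
have span_inv v : Lat T rho (closed_span [set R0 v]).
  split=> // y w Ty.
  have : T `<=` [set y | T y /\ closed_span [set R0 v] (rho y (R0 v))].
    apply: (taf_sub (m := m)); first exact: rep_elt_preimage.
    move=> l u ml uu; have Tu : T (munit u) := taf_munit uu.
    split=> //; rewrite /R0 -(rep_mul rep) //.
    have [+ _] := He l u ml uu => /(JR _ v (mT Tu Te))[]->.
      by have [_ ? _] := span_sub (R0 v).
    by move=> M [_]; apply.
  move=> /(_ y Ty)[_]; rewrite closed_span_line => -[c _ yc] [b _ <-].
  by rewrite (rep_vZ rep) // -yc scalerA; exists (b * c).
pose M := [set v | R0 v = 0].
have sM : closed_subspace M := rep_vec_preimage rep (closed_subspace0 H) Te.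
have LM : Lat T rho M.
  split=> // y v Ty Mv.
  suff /(_ y Ty)[] : T `<=` [set y | T y /\ M (rho y v)] by [].
  apply: (taf_sub (m := m)); first exact: rep_elt_preimage.
  move=> l u ml uu; have Tu : T (munit u) := taf_munit uu.
  split=> //; rewrite /M /R0 /= -(rep_mul rep) //.
  have [_] := He l u ml uu => /(JR _ v (mT Te Tu))[]->//.
have [v Mv] : exists v, ~ M v.
  apply: contrapT => no; apply: Je; split=> // v.
  by apply: contrapT => Mv; apply: no; exists v.
have [h h0 hM] := exists_orthogonal sM Mv.
have Mh : ~ M h by move=> /hM/inner_eq0/eqP; rewrite (negbTE h0).
have hh0 : inner h h != 0 by rewrite dnorm_eq0.
(* Normalized so that [R0 h = inner h h *: g], the value of [rank_one g h] at [h]. *)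
pose g := R0 ((inner h h)^-1 *: h).
have gE : g = (inner h h)^-1 *: R0 h by rewrite /g /R0 (rep_vZ rep).
have g0 : g != 0 by rewrite gE scaler_eq0 invr_eq0 (negbTE hh0) /=; apply/eqP.
have spang (w : H) : closed_span [set w] w by move=> L [_]; apply.
have Lg : Lat T rho (closed_span [set g]) by apply: span_inv.
(* The lines of [R0 w] and [g] are comparable; as [g] is non-zero, either inclusion puts [R0 w] in
   the line of [g]. *)
have range w : closed_span [set g] (R0 w).
  have [/(_ _ (spang _))//|/(_ _ (spang _))] := nest (span_inv w) Lg.
  rewrite !closed_span_line => -[c _ cg]; exists c^-1 => //.
  rewrite -cg scalerA mulVf ?scale1r //.
  by apply: contra_neq g0 => c0; rewrite -cg c0 scale0r.
have codim w u : ~ M w -> exists c : C, M (u - c *: w).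
  move=> Mw; have := range u; have := range w; rewrite closed_span_line.
  move=> [a _ aw] [b _ bu]; exists (b / a); rewrite /M /= /R0 (rep_vB rep) //.
  rewrite (rep_vZ rep) // -/R0 -aw -bu scalerA divfK ?subrr //.
  by apply/eqP => a0; apply: Mw; rewrite /M /= -aw a0 scale0r.
have R0E w : R0 w = inner w h *: g.
  have [c Mc] := codim h w Mh.
  have whc : inner w h = c * inner h h.
    have := inner_eq0C (hM _ Mc); rewrite linearBl linearZl_LR /= => /subr0_eq.
    exact.
  move: Mc; rewrite /M /= /R0 (rep_vB rep) // (rep_vZ rep) // => /subr0_eq ->.
  by rewrite gE scalerA whc mulfK.
(* The kernel has codimension one, so an invariant subspace that is not inside it contains it
   together with a complementary vector, and is everything. *)
have omM : one_minus (Lat T rho) = M.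
  apply: one_minusE => //; first by move=> MT; apply: Mh; rewrite MT.
  move=> L LL LT; have [//|ML u Lu] := nest LL LM.
  apply: contrapT => Mu; apply: LT; apply/seteqP; split=> // w _.
  have [c Mc] := codim u w Mu; have [sL _] := LL.
  rewrite -(subrK (c *: u) w); apply: (subspaceD sL); first exact: ML.
  exact: (subspaceZ _ sL).
exists g, h; split=> //.
- apply: zero_plusE => //.
    by move=> L0; have := spang g; rewrite L0 /= => g00; rewrite g00 eqxx in g0.
  move=> L LL L0; have [gL|//] := nest LL Lg.
  have [u Lu u0] : exists2 u, L u & u <> 0.
    apply: contrapT => no; apply: L0; apply/seteqP; split=> [u Lu /=|_ ->].
      by apply: contrapT => u0; apply: no; exists u.
    by case: LL => -[].
  have := gL _ Lu; rewrite closed_span_line => -[c _ cu].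
  move=> _ [b _ <-]; have [sL _] := LL; apply: (subspaceZ _ sL).
  have -> : g = c^-1 *: u.
    rewrite -cu scalerA mulVf ?scale1r //.
    by apply/eqP => c0; apply: u0; rewrite -cu c0 scale0r.
  exact: (subspaceZ _ sL).
- rewrite omM; apply/seteqP; split=> [w wM|w].
    have [c Mc] := codim h w Mh; rewrite closed_span_line; exists c => //.
    apply/esym/subr0_eq/inner_eq0; rewrite linearBl /= linearZl_LR /=.
    by rewrite (wM _ Mc) (hM _ Mc) mulr0 subrr.
  by rewrite closed_span_line => -[c _ <-] y My; rewrite linearZl_LR /= hM ?mulr0.
- by exists (munit e) => //; apply/funext => w; apply: R0E.
Qed.

End NestRepresentation.

(** * From a rank one operator to complete meet irreducibility *)

Section StarOnDiagonal.
Variables (R : realType) (S : tafSystem R) (A : cstarAlgType R).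
Variable incl : forall i, matAlg R (dims S i) -> A.
Arguments incl : clear implicits.
Hypothesis lim : is_cstar_limit incl.
Variables (H : hilbertType R) (rho : A -> H -> H).
Local Notation C := R[i].
Local Notation idx l := (mat_index (dims S l)).
Local Notation T := (taf_algebra incl).
Local Notation munit := (@munit R S A incl _).
Local Notation rproj := (@rproj R S A incl _).
Local Notation cproj := (@cproj R S A incl _).
Hypothesis rep : representation T rho.
Hypothesis nest : forall M N, Lat T rho M -> Lat T rho N -> M `<=` N \/ N `<=` M.
Hypothesis star_rho : star_rep_on rho (alg_diagonal T).

Let sT : closed_subspace T := taf_subspace lim.
Let mT : forall x y, T x -> T y -> T (x ** y) := taf_mul lim.
Local Notation J := (rep_ker T rho).

Variables (g h : H) (a : A).
Hypotheses (g0 : g != 0) (h0 : h != 0).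
Hypothesis zpg : zero_plus (Lat T rho) = closed_span [set g].
Hypothesis omh : orthocomplement (one_minus (Lat T rho)) = closed_span [set h].
Hypotheses (Ta : T a) (ra : rho a = rank_one g h).

Let rproj_adj l (u : idx l) v w :
  inner (rho (rproj u) v) w = inner v (rho (rproj u) w).
Proof.
rewrite star_rho; first by rewrite (star_rproj lim).
exact: (taf_diagonal lim).
Qed.

Let cproj_adj l (u : idx l) v w :
  inner (rho (cproj u) v) w = inner v (rho (cproj u) w).
Proof.
rewrite star_rho; first by rewrite (star_cproj lim).
exact: (taf_diagonal lim).
Qed.

(** On the line of [w] the idempotent acts as a scalar equal to its square. *)
Let idem_fix x w : T x -> x ** x = x -> closed_span [set w] (rho x w) ->
  rho x w != 0 -> rho x w = w.
Proof.
move=> Tx xx; rewrite closed_span_line => -[c _ xw] x0.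
have : c *: rho x w = rho x w by rewrite -{2}xx (rep_mul rep) // -{2}xw (rep_vZ rep).
move/eqP; rewrite -subr_eq0 -{2}(scale1r (rho x w)) -scalerBl scaler_eq0.
by rewrite (negbTE x0) orbF subr_eq0 => /eqP c1; rewrite -xw c1 scale1r.
Qed.

Let rproj_g l (u : idx l) : rho (rproj u) g != 0 -> rho (rproj u) g = g.
Proof.
have [[_ Lg] _] := zero_plusP nest g0 zpg.
have Tu : T (rproj u) := @taf_rproj _ _ _ incl _ u.
apply: idem_fix => //; first exact: (rproj_idem lim).
by apply: Lg => // M [_]; apply.
Qed.

(** [one_minus] is invariant and [rho (cproj u)] is self-adjoint, so the orthocomplement, which is
    the line of [h], is invariant under it. *)
Let cproj_h l (u : idx l) : rho (cproj u) h != 0 -> rho (cproj u) h = h.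
Proof.
have [[_ LI] _ _] := one_minusP h0 omh.
have Tu : T (cproj u) := @taf_cproj _ _ _ incl _ u.
apply: idem_fix => //; first exact: (cproj_idem lim).
rewrite -omh => y Iy; rewrite cproj_adj.
have hh : orthocomplement (one_minus (Lat T rho)) h.
  by rewrite omh => M [_]; apply.
by apply/hh/LI.
Qed.

(** Some unit [u] in the expansion of [X] has a non-zero pairing with [h] and [g]. It absorbs its
    range and source projections, so these do not annihilate [g] and [h], and therefore fix them. *)
Let select l (X : matAlg R (dims S l)) : upper_triangular X ->
  inner (rho (incl l X) h) g != 0 ->
  exists u : idx l, rho (rproj u) g = g /\ rho (cproj u) h = h.
Proof.
move=> uX ne.
have TX u : T (coef X u *: munit u).
  have [uu|/(upper_coef X).1->//] := boolP (up_idx u).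
    by apply: (subspaceZ _ sT); apply: taf_munit.
  by rewrite scale0r; case: sT.
have [u [cu uu]] : exists u, coef X u != 0 /\ inner (rho (munit u) h) g != 0.
  apply: contrapT => no; case/eqP: ne.
  rewrite (mat_unit_sum X) (incl_sum lim).
  rewrite (eq_bigr (fun u => coef X u *: munit u)) => [|u _]; last first.
    by rewrite (inclZ lim) munitE.
  rewrite (rep_sum sT rep) //; rewrite linear_sumlz big1 // => u _.
  have [c0|c0] := eqVneq (coef X u) 0.
    by rewrite c0 scale0r (rep_0 sT rep) linear0l.
  have upu : up_idx u by apply: contraR c0 => /(upper_coef X).1 ->.
  rewrite (rep_Z sT rep); last exact: taf_munit.
  rewrite linearZl_LR /=; apply/eqP; rewrite mulf_eq0 (negbTE c0) /=.
  by apply: contraT => ne; case: no; exists u.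
have upu : up_idx u by apply: contraR cu => /(upper_coef X).1 ->.
have Tu : T (munit u) := taf_munit upu.
exists u; split.
  apply: rproj_g; apply: contraNneq uu => e0.
  rewrite -(rprojM lim) (rep_mul rep) ?rproj_adj ?e0 ?linear0r //.
  exact: taf_rproj.
apply: cproj_h; apply: contraNneq uu => e0.
rewrite -(munitMc lim) (rep_mul rep) ?e0 ?(rep_v0 rep) ?linear0l //.
exact: taf_cproj.
Qed.

(** The vectors annihilated by [rho x] and by every [rho x] after [rho z] form a proper invariant
    subspace, contained in [one_minus], which misses [h]: so some [x'] in [K] does not annihilate
    [h]. The cyclic subspace of [rho x' h] is then non-zero and contains [g]. *)
Let connect K : closed_ideal T K -> ~ (K `<=` J) ->
  exists2 b, K b & inner (rho b h) g != 0.
Proof.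
move=> idK KJ; have [KT sK KM] := idK.
have [x Kx [v xv]] : exists2 x, K x & exists v, rho x v != 0.
  apply: contrapT => no; apply: KJ => x Kx; split; first exact: KT.
  move=> v; apply/eqP; apply: contraT => xv.
  by case: no; exists x => //; exists v.
have Tx := KT _ Kx.
pose M := [set v | rho x v = 0 /\ forall z : {z | T z}, rho x (rho (sval z) v) = 0].
have LM : Lat T rho M.
  split.
    have s0 := closed_subspace0 H.
    have sx := rep_vec_preimage rep s0 Tx.
    apply: (closed_subspaceI sx); apply: closed_subspace_forall => -[z Tz] /=.
    exact: (rep_vec_preimage rep sx Tz).
  move=> y w Ty [w0 wz]; split; first exact: (wz (exist _ y Ty)).
  move=> [z Tz] /=; rewrite -(rep_mul rep w Tz Ty).
  exact: (wz (exist _ _ (mT Tz Ty))).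
have [_ nIh maxI] := one_minusP h0 omh.
have [x' Kx' x'h] : exists2 x', K x' & rho x' h != 0.
  have [xh|xh] := eqVneq (rho x h) 0; last by exists x.
  have [[z Tz] xzh] : exists z : {z | T z}, rho x (rho (sval z) h) != 0.
    apply: contrapT => no; apply: nIh; apply: (maxI M LM); last first.
      split=> // z; apply/eqP; apply: contraT => xz.
      by case: no; exists z.
    by move=> MT; have [] : M v by [rewrite MT]; move: xv => /eqP.
  exists (x ** z); first by have [] := KM _ _ Tz Kx.
  by rewrite (rep_mul rep).
have Tx' := KT _ Kx'.
have [_ F1] := zero_plusP nest g0 zpg.
have L2 := cyclic_Lat sT mT rep (rho x' h).
have Cg := F1 _ L2 _.
have {Cg} : closure [set v | exists c x0, T x0 /\ v = c *: rho x' h + rho x0 (rho x' h)] g.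
  apply: Cg => e; have : [set (0 : H)] (rho x' h).
    rewrite -e; apply: subset_closure; exists 1, 0.
    by split; [case: sT | rewrite scale1r (rep_0 sT rep) addr0].
  by move=> /= e0; rewrite e0 eqxx in x'h.
(* A vector closer to [g] than [nm g] cannot be orthogonal to [g]. *)
move=> /closureP/(_ (nm g)) []; first by rewrite lt_neqAle nm_ge0 andbT eq_sym;
  apply: contra_neq g0 => /nm_eq0.
move=> _ [c [y [Ty ->]]] /inner_near_neq0 ne; exists (c *: x' + y ** x').
  by case: sK => _ _; apply => //; have [] := KM _ _ Ty Kx'.
by rewrite (rep_linear rep) ?(rep_mul rep) //; apply: mT.
Qed.

Lemma rank_one_mem_ideal K : closed_ideal T K -> J `<=` K -> ~ (K `<=` J) -> K a.
Proof.
move=> idK JK KJ; have [b Kb bhg] := connect idK KJ.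
have [KT sK KM] := idK; have Tb := KT _ Kb; have [cK _ _] := sK.
have [c c0 cP] := rep_nm_bound rep.
pose k := c * nm h * nm g.
have kP y : T y -> nm (inner (rho y h) g : C^o) <= k * nm y.
  move=> Ty; apply: le_trans (cauchy_schwarz _ _) _.
  have -> : k * nm y = c * nm y * nm h * nm g by rewrite /k; ring.
  by apply: ler_wpM2r; [exact: nm_ge0|exact: cP].
pose be := nm (inner (rho b h) g : C^o).
have be0 : 0 < be.
  by rewrite lt_neqAle nm_ge0 andbT eq_sym; apply: contra_neq bhg => /(@nm_eq0 R C^o).
have k0 : 0 < k.
  rewrite lt_neqAle !mulr_ge0 ?nm_ge0 // andbT; apply/eqP => k00.
  by have := kP b Tb; rewrite -k00 mul0r leNgt be0.
(* With [d <= q^-1] the pairing of [incl l Y] keeps at least half of [be], so the coefficient [ga]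
   has modulus at least [q^-1]; [d <= 1] bounds [al] by [nm a + 1]. The final error is below
   [d * D], whence [d <= e / D]. *)
pose q := 2 * k / be; have q0 : 0 < q by rewrite divr_gt0 // mulr_gt0.
apply: closed_approx cK _ => e e0.
pose D := 1 + (nm a + 1) * q.
have D0 : 0 < D by rewrite ltr_wpDr // mulr_ge0 ?addr_ge0 ?nm_ge0 // ltW.
pose d := Num.min 1 (Num.min q^-1 (e / D)).
have d0 : 0 < d by rewrite !lt_min ltr01 invr_gt0 q0 divr_gt0.
have [n1 P1] := taf_approx lim Ta d0; have [n2 P2] := taf_approx lim Tb d0.
pose l := maxn n1 n2.
have [X uX aX] := P1 l (leq_maxl _ _); have [Y uY bY] := P2 l (leq_maxr _ _).
have TX : T (incl l X) := taf_incl uX; have TY : T (incl l Y) := taf_incl uY.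
have d1 : d <= 1 by rewrite ge_min lexx.
have dq : d <= q^-1 by rewrite !ge_min lexx orbT.
have de : d * D <= e by rewrite -ler_pdivlMr // !ge_min lexx !orbT.
have kq : k * q^-1 = be / 2.
  by rewrite /q; field; rewrite ?lt0r_neq0.
have Yhg : be / 2 <= nm (inner (rho (incl l Y) h) g : C^o).
  have : be <= nm (inner (rho (b - incl l Y) h) g : C^o) +
               nm (inner (rho (incl l Y) h) g : C^o).
    apply: le_trans (nmD _ _).
    by rewrite -linearDl (rep_B rep) // subrK.
  have := kP _ (subspaceB sT Tb TY).
  have : k * nm (b - incl l Y) <= k * q^-1.
    by apply: ler_wpM2l; rewrite ltW // (lt_le_trans bY).
  by rewrite kq; lra.
have [|u [ug uh]] := select uY.
  by apply: contraTneq Yhg => ->; rewrite nm0 -ltNge divr_gt0.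
have Tr : T (rproj u) := @taf_rproj _ _ _ incl _ u.
have Tc : T (cproj u) := @taf_cproj _ _ _ incl _ u.
pose al := coef X u; pose ga := coef Y u.
have comp y : T y -> inner (rho (rproj u ** y ** cproj u) h) g = inner (rho y h) g.
  by move=> Ty; rewrite !(rep_mul rep) ?uh ?rproj_adj ?ug //; apply: mT.
have gaP : q^-1 <= nm (ga : C^o).
  have := kP _ (mT (mT Tr TY) Tc); rewrite comp // (compress_incl lim) nmZ.
  rewrite (nm_munit lim) mulr1 -/ga => kga.
  rewrite -(@ler_pM2l _ k) // kq; exact: le_trans kga.
have ga0 : ga != 0.
  by apply: contraTneq gaP => ->; rewrite nm0 -ltNge invr_gt0.
have alP : nm (al : C^o) <= nm a + 1.
  have : nm (al *: munit u) <= nm (incl l X).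
    by rewrite -(compress_incl lim) nm_compress.
  rewrite nmZ (nm_munit lim) mulr1 => /le_trans; apply.
  have -> : incl l X = a - (a - incl l X) by rewrite opprB addrC subrK.
  by apply: le_trans (nmB _ _) _; rewrite lerD2l ltW // (lt_le_trans aX).
(* The first summand lies in the kernel, because compression by projections fixing [g] and [h]
   preserves the rank one operator. The second replaces the corner of [a], close to [al *: munit u],
   by a multiple of the corner of [b], close to [ga *: munit u]. *)
exists ((a - rproj u ** a ** cproj u) + (al / ga) *: (rproj u ** b ** cproj u)).
  apply: (subspaceD sK); last first.
    by apply: (subspaceZ _ sK); apply: (ideal_mul idK).
  have TT := mT (mT Tr Ta) Tc.
  apply: JK; split; first exact: (subspaceB sT).
  move=> v; rewrite (rep_B rep) // !(rep_mul rep) //; last exact: mT.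
  by rewrite ra /rank_one (rep_vZ rep) // ug cproj_adj uh subrr.
rewrite opprD opprB addrA (addrC a) subrK.
have -> : rproj u ** a ** cproj u - (al / ga) *: (rproj u ** b ** cproj u) =
   rproj u ** (a - incl l X) ** cproj u -
   (al / ga) *: (rproj u ** (b - incl l Y) ** cproj u).
  rewrite !amulBr !amulBl !(compress_incl lim) scalerBr scalerA divfK //.
  by rewrite opprB addrA subrK.
apply: (@lt_le_trans _ _ (d * D)) => //.
rewrite /D mulrDr mulr1; apply: le_lt_trans (nmB _ _) _; apply: ltr_leD.
  exact: le_lt_trans (nm_compress lim _ _) aX.
rewrite nmZ nm_div mulrC; apply: ler_pM; rewrite ?nm_ge0 ?divr_ge0 ?nm_ge0 //.
  exact: le_trans (nm_compress lim _ _) (ltW bY).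
apply: ler_pM; rewrite ?nm_ge0 ?invr_ge0 ?nm_ge0 //.
rewrite -[q]invrK lef_pV2 ?posrE ?invr_gt0 //.
by apply: lt_le_trans gaP; rewrite invr_gt0.
Qed.

(** If the kernel is not in the family, every member is strictly larger and contains [a], so [a]
    lies in the intersection, the kernel; but [rho a h = inner h h *: g] is non-zero. *)
Lemma rank_one_cmi : completely_meet_irreducible T J.
Proof.
split; first exact: rep_ker_ideal.
move=> F FJ JF; apply: contrapT => nFJ.
have : J a.
  rewrite JF; split=> // K FK; have [idK JK] := FJ K FK.
  apply: rank_one_mem_ideal => // KJ; apply: nFJ.
  by have <- : K = J by apply/seteqP.
move=> [_ /(_ h)]; rewrite ra /rank_one => /eqP.
by rewrite scaler_eq0 dnorm_eq0 (negbTE h0) (negbTE g0).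
Qed.

End StarOnDiagonal.

Theorem theorem2p3 (R : realType) (S : tafSystem R) (AF : cstarAlgType R)
    (incl : forall i : nat, matAlg R (dims S i) -> AF)
    (lim_incl : is_cstar_limit incl)
    (H : hilbertType R) (rho : AF -> H -> H)
    (nest_rho : nest_representation (taf_algebra incl) rho)
    (star_rho : star_rep_on rho (alg_diagonal (taf_algebra incl))) :
  completely_meet_irreducible (taf_algebra incl)
    (rep_ker (taf_algebra incl) rho)
  <->
  exists g h : H,
    [/\ g != 0, h != 0,
        zero_plus (Lat (taf_algebra incl) rho) = closed_span [set g],
        orthocomplement (one_minus (Lat (taf_algebra incl) rho))
          = closed_span [set h]
      & exists2 x, taf_algebra incl x & rho x = rank_one g h].
Proof.
have [rep nest] := nest_rho; split; first exact: cmi_rank_one.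
move=> [g [h [g0 h0 zg oh [a Ta ra]]]].
exact: (rank_one_cmi lim_incl rep nest star_rho g0 h0 zg oh Ta ra).
Qed.
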